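(* In the two-firm negotiation game described in the context, suppose $\beta_1\le\beta_2$. Then the alternating iterative procedure $S_0:=\emptyset$, $T_n:=\Gamma_2(S_n)$, $S_{n+1}:=\Gamma_1(T_n)$ ($n=0,1,2,\dots$) terminates after one iteration (i.e. $S_n=S_0$ and $T_n=T_0$ for all $n$) and gives a sharp inter-personal equilibrium. That is, with $S_\infty:=\bigcup_nS_n$ and $T_\infty:=\bigcap_nT_n$, $$(S_\infty,T_\infty)=(S_0,T_0)=(\emptyset,(0,y_2^*]\cap\mathbb{X})\in\widehat{\mathcal{E}}.$$
   Context: Two-firm negotiation game. $\mathbb{Z}_+=\{0,1,2,\dots\}$, $\mathbb{N}=\{1,2,\dots\}$. Fix $u>1$ and $p\in(0,1)$ with $p\ge\frac1{u+1}$. $X=(X_t)_{t\in\mathbb{Z}_+}$ is the time-homogeneous Markov chain on $\mathbb{X}=\{u^j:j=0,\pm1,\pm2,\dots\}$ with $\mathbb{P}_x(X_1/x=u)=p$ and $\mathbb{P}_x(X_1/x=1/u)=1-p$ for all $x\in\mathbb{X}$ (so $X$ is a submartingale); $\mathbb{P}_x$ is the law of $X$ started at $x$, $\mathbb{E}_x$ its expectation, $\mathcal{B}=2^{\mathbb{X}}$, and $\mathcal{T}$ is the set of stopping times of the filtration generated by $X$ (allowed to take the value $+\infty$). Fix $R>0$, $N\in(R/2,R)$ and $K:=R-N\in(0,R/2)$. For $i\in\{1,2\}$ and $x\in\mathbb{X}$, $f_i(x)=(K-x)^+$, $g_i(x)=N$, and $h_i:\mathbb{X}\to\mathbb{R}_+$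 is any function with $f_i\le h_i\le g_i$; the discount functions are $\delta_i(t)=\frac1{1+\beta_it}$ with constants $\beta_i>0$. For $\tau,\sigma\in\mathcal{T}$, $F_i(\tau,\sigma):=\delta_i(\tau)f_i(X_\tau)1_{\{\tau<\sigma\}}+\delta_i(\sigma)g_i(X_\sigma)1_{\{\tau>\sigma\}}+\delta_i(\tau)h_i(X_\tau)1_{\{\tau=\sigma\}}$, with $F_i(\tau,\sigma):=\limsup_{t\to\infty}\delta_i(t)h_i(X_t)$ on $\{\tau=\sigma=+\infty\}$, and $J_i(x,\tau,\sigma):=\mathbb{E}_x[F_i(\tau,\sigma)]$ ($\tau$ is Player/Firm $i$'s stopping time, $\sigma$ the other's). For $S\in\mathcal{B}$, $\rho_S:=\inf\{t\ge0:X_t\in S\}$ and $\rho_S^+:=\inf\{t>0:X_t\in S\}$ ($\inf\emptyset=\infty$). Equilibria. For $S,T\in\mathcal{B}$ let $\Theta_i^T(S):=\{x\in S: J_i(x,0,\rho_T)\ge J_i(x,\rho_S^+,\rho_T)\}\cup\{x\notin S: J_i(x,0,\rho_T)>J_i(x,\rho_S^+,\rho_T)\}$ and $\mathcal{E}_i^T:=\{S\in\mathcal{B}:\Theta_i^T(S)=S\}$ (intra-personal equilibria of Player $i$ with respect to $T$). For $S\in\mathcal{E}_i^T$ let $U_i^T(x,S):=\max\{J_i(x,0,\rho_T),J_i(x,\rho_S^+,\rho_T)\}$; $\widehat{\mathcal{E}}_i^T$ is the set of $S\in\mathcal{E}_i^T$ with $U_i^T(x,S)\ge U_i^T(x,R')$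 for all $R'\in\mathcal{E}_i^T$, $x\in\mathbb{X}$. A pair $(S,T)$ is a sharp inter-personal equilibrium if $S\in\widehat{\mathcal{E}}_1^T$ and $T\in\widehat{\mathcal{E}}_2^S$; $\widehat{\mathcal{E}}$ is the set of these. The maps $\Gamma_i$. Let $V_i^T(x,S):=\sup\{\mathbb{E}_x[F_i(\tau,\rho_T)]:\tau\in\mathcal{T},\,1\le\tau\le\rho_S^+\}$ and $\Phi_i^T(S):=S\cup\{x\notin S:J_i(x,0,\rho_T)>V_i^T(x,S)\}$. Put $S_i^1(T):=\Phi_i^T(\emptyset)$, $S_i^n(T):=\Phi_i^T(S_i^{n-1}(T))$ for $n\ge2$, and $\Gamma_i(T):=\bigcup_{n\in\mathbb{N}}S_i^n(T)$. Threshold. Let $Y$ be a random walk on the integers with $P(Y_{t+1}-Y_t=1)=p$, $P(Y_{t+1}-Y_t=-1)=1-p$, let $\xi:=\inf\{t\ge0:Y_t=0\}$, and $\alpha_i^1:=E\big[\frac1{1+\beta_i\xi}\,\big|\,Y_0=1\big]$ (the integrand being $0$ when $\xi=\infty$). Then $y_i^*:=\min\big\{\big[\frac{1-\alpha_i^1}{u-\alpha_i^1}K,\infty\big)\cap\mathbb{X}\big\}$. *)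

(* Defs.v *)
From HB Require Import structures.
From mathcomp Require Import all_boot all_order all_algebra.
From mathcomp Require Import all_classical all_reals all_analysis.
Import Order.TTheory GRing.Theory Num.Theory.
Import numFieldNormedType.Exports.

Set Implicit Arguments.
Unset Strict Implicit.
Unset Printing Implicit Defensive.

Local Open Scope classical_set_scope.
Local Open Scope ring_scope.

(** Random times take values in [option nat]; [None] stands for +oo. *)

Definition xle (s t : option nat) : bool :=
  match s, t with
  | _, None => true
  | Some m, Some n => (m <= n)%N
  | None, Some _ => false
  end.

Definition xinf (A : set nat) : option nat :=
  if pselect (exists n, `[< A n >]) is left exA then Some (ex_minn exA)
  else None.

Section hitting.
Context {Omega E : Type}.

Definition hit (X : nat -> Omega -> E) (S : set E) (w : Omega) : option nat :=
  xinf [set t | S (X t w)].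

Definition hit_pos (X : nat -> Omega -> E) (S : set E) (w : Omega)
    : option nat :=
  xinf [set t | (0 < t)%N /\ S (X t w)].

(** F_t is generated by X_0, ..., X_t; the countable state space carries the
    discrete sigma-algebra, whence the arbitrary set [A]. *)
Definition natural_filtration (X : nat -> Omega -> E) (t : nat)
    : set (set Omega) :=
  <<s [set B | exists s (A : set E), (s <= t)%N /\ B = X s @^-1` A] >>.

Definition stopping_time (X : nat -> Omega -> E) (tau : Omega -> option nat)
    : Prop :=
  forall t, natural_filtration X t [set w | xle (tau w) (Some t)].

End hitting.

(** The Markov property with one-step transition probabilities [q], in product
    form so that null events need no separate treatment:
    P(X_0 = x_0, ..., X_{n+1} = x_{n+1})
      = P(X_0 = x_0, ..., X_n = x_n) * q x_n x_{n+1}. *)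
Definition markov_chain {R : realType} {d} {Omega : measurableType d}
    (E : Type) (q : E -> E -> R) (P : probability Omega R)
    (X : nat -> Omega -> E) : Prop :=
  (forall t (A : set E), measurable (X t @^-1` A)) /\
  (forall n (x : nat -> E),
    P [set w | forall s, (s <= n.+1)%N -> X s w = x s] =
    (P [set w | forall s, (s <= n)%N -> X s w = x s] *
      (q (x n) (x n.+1))%:E)%E).

Definition two_point {R : realType} {E : eqType} (up down : E -> E) (p : R)
    (x y : E) : R :=
  if y == up x then p else if y == down x then 1 - p else 0.

Definition states {R : realType} (u : R) : set R :=
  range (fun j : int => u ^ j).

(** [P x] is the law under which X starts at x; only x in [states u] matter. *)
Definition multiplicative_walk {R : realType} {d} {Omega : measurableType d}
    (u p : R) (P : R -> probability Omega R) (X : nat -> Omega -> R) : Prop :=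
  (forall t w, states u (X t w)) /\
  (forall x, states u x ->
    P x (X 0%N @^-1` [set x]) = 1%E /\
    markov_chain (two_point (fun y => u * y) (fun y => y / u) p) (P x) X).

Definition integer_walk {R : realType} {d} {Omega : measurableType d}
    (p : R) (Q : probability Omega R) (Y : nat -> Omega -> int) : Prop :=
  markov_chain (two_point (fun k : int => k + 1) (fun k : int => k - 1) p) Q Y.

Definition discount {R : realType} (beta : R) (t : nat) : R :=
  1 / (1 + beta * t%:R).

Record player (R : realType) := Player {
  disc : nat -> R;
  concede : R -> R;
  yielded_to : R -> R;
  tie : R -> R
}.

(** The functions f_i, g_i and h_i of the negotiation game. *)
Definition firm {R : realType} (K N beta : R) (h : R -> R) : player R :=
  Player (discount beta) (fun x => Num.max (K - x) 0) (fun _ => N) h.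

Section game.
Context {R : realType} {d : measure_display} {Omega : measurableType d}.
Variables (XX : set R) (P : R -> probability Omega R) (X : nat -> Omega -> R).
Variable i : player R.

Definition payoff (tau sigma : Omega -> option nat) (w : Omega) : R :=
  match tau w, sigma w with
  | Some s, Some t =>
      if (s < t)%N then disc i s * concede i (X s w)
      else if (t < s)%N then disc i t * yielded_to i (X t w)
      else disc i s * tie i (X s w)
  | Some s, None => disc i s * concede i (X s w)
  | None, Some t => disc i t * yielded_to i (X t w)
  | None, None => limn_sup (fun t => disc i t * tie i (X t w))
  end.

Definition J (x : R) (tau sigma : Omega -> option nat) : \bar R :=
  'E_(P x)[payoff tau sigma].

Definition Jstop (T : set R) (x : R) : \bar R :=
  J x (fun=> Some 0%N) (hit X T).

Definition Jcont (T S : set R) (x : R) : \bar R :=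
  J x (hit_pos X S) (hit X T).

Definition Theta (T S : set R) : set R :=
  [set x | XX x /\ S x /\ (Jcont T S x <= Jstop T x)%E] `|`
  [set x | XX x /\ ~ S x /\ (Jcont T S x < Jstop T x)%E].

Definition intra_equilibrium (T S : set R) : Prop :=
  S `<=` XX /\ Theta T S = S.

Definition U (T : set R) (x : R) (S : set R) : \bar R :=
  Order.max (Jstop T x) (Jcont T S x).

Definition optimal_intra_equilibrium (T S : set R) : Prop :=
  intra_equilibrium T S /\
  forall S', intra_equilibrium T S' ->
    forall x, XX x -> (U T x S' <= U T x S)%E.

Definition V (T : set R) (x : R) (S : set R) : \bar R :=
  ereal_sup [set J x tau (hit X T) | tau in
    [set tau | stopping_time X tau /\
       forall w, xle (Some 1%N) (tau w) /\ xle (tau w) (hit_pos X S w)]].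

Definition Phi (T S : set R) : set R :=
  S `|` [set x | XX x /\ ~ S x /\ (V T x S < Jstop T x)%E].

Definition Gamma (T : set R) : set R :=
  \bigcup_(n in [set n | (1 <= n)%N]) iter n (Phi T) set0.

End game.

Definition sharp_equilibrium {R : realType} {d} {Omega : measurableType d}
    (XX : set R) (P : R -> probability Omega R) (X : nat -> Omega -> R)
    (i1 i2 : player R) (ST : set R * set R) : Prop :=
  optimal_intra_equilibrium XX P X i1 ST.2 ST.1 /\
  optimal_intra_equilibrium XX P X i2 ST.1 ST.2.

Definition cond_expectation {R : realType} {d} {Omega : measurableType d}
    (Q : probability Omega R) (Z : Omega -> R) (A : set Omega) : R :=
  fine 'E_Q[Z \* \1_A] / fine (Q A).

Definition alpha {R : realType} {d} {Omega : measurableType d}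
    (beta : R) (Q : probability Omega R) (Y : nat -> Omega -> int) : R :=
  cond_expectation Q
    (fun w => if hit Y [set 0] w is Some t then discount beta t else 0)
    (Y 0%N @^-1` [set 1]).

(** [xget] returns the (unique) minimum; the default 0 is used only when there
    is none. *)
Definition set_min {R : realType} (A : set R) : R :=
  xget 0 (A `&` lbound A).

Definition threshold {R : realType} {d} {Omega : measurableType d}
    (u K beta : R) (Q : probability Omega R) (Y : nat -> Omega -> int) : R :=
  let a := alpha beta Q Y in
  set_min (`[(1 - a) / (u - a) * K, +oo[%classic `&` states u).

(* Main.v *)
Require Import Defs.
From mathcomp Require Import all_boot all_order all_algebra.
From mathcomp Require Import all_classical all_reals all_analysis.
From mathcomp Require Import measurable_realfun lra ring zify.
Import Order.TTheory GRing.Theory Num.Theory.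
Import numFieldNormedType.Exports.

(** Fix a state y and measure the walk by its level above y, that is, by the
    integer k with X = u^k y: this is a walk on the integers with steps 1 and
    -1. For fixed p and beta, let [pv t k] be the expected discount factor, seen
    from time t at level k, at the moment when level 0 is reached. As a function
    of time and level, [pv] is harmonic at the levels k > 0, so that by optional
    stopping r * [pv 0 k] is the value of waiting for level 0 to receive r
    there. The number alpha of the threshold is [pv 0 1], and since hyperbolic
    discounting satisfies delta(s) delta(t) <= delta(s + t), splitting the
    descent into k descents by one level gives [pv t k] >= delta(t) alpha^k.

    Let y be the threshold and T the half-line (0, y]. By convexity of
    m |-> (1 - alpha) u^m + (u - 1) alpha^m, which has equal values at 0 and 1,
    conceding at level m above y pays at most alpha^m (K - y) ([above_threshold]).

    Firm 2 faces an opponent who never stops. Outside T, waiting for T is at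
    least as good as conceding ([alone_wait]), and at least as good as waiting
    for any larger set ([alone_wait_best]). Inside T the states are collected
    one by one from below by the iterates of Phi. The low ones enter at once,
    because a single period of discounting already costs too much
    ([concede_low]). Once all states up to y' are collected, the next state u y'
    enters as well ([concede_now]): for a constant M determined by the state,
    the excess over the value of waiting for y' of conceding m levels above y'
    is at most M (1 - alpha^m), this bound is a supermartingale because
    alpha <= (1 - p) / p, and it is discounted by at least one period. Hence Gamma_2 of
    the empty set is T. The iterates of Phi are contained in every
    intra-personal equilibrium, so every equilibrium contains T, and T is
    optimal.

    Firm 1 faces T. Being at least as patient, it has a larger alpha, and N
    exceeds K - y, so waiting for firm 2 to give in is at least as good as
    conceding in every state, and as waiting for any set in which to concede
    ([never_stop], [never_stop_best]). So the empty set is an optimal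
    equilibrium, and Gamma_1 of T, which is contained in every equilibrium, is
    empty. *)

Set Implicit Arguments.
Unset Strict Implicit.
Unset Printing Implicit Defensive.

Local Open Scope classical_set_scope.
Local Open Scope ring_scope.

(** * Hyperbolic discounting *)

Section discount_facts.
Context {R : realType}.
Variables (beta : R) (beta0 : 0 < beta).
Local Notation delta := (discount beta).

Lemma discount_den_gt0 t : 0 < 1 + beta * t%:R.
Proof. by rewrite ltr_wpDr // mulr_ge0 // ltW. Qed.

Lemma discountE t : delta t = (1 + beta * t%:R)^-1.
Proof. by rewrite /discount mul1r. Qed.

Lemma discount_gt0 t : 0 < delta t.
Proof. by rewrite discountE invr_gt0 discount_den_gt0. Qed.

Lemma discount_ge0 t : 0 <= delta t.
Proof. exact/ltW/discount_gt0. Qed.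

Lemma discount0 : delta 0 = 1.
Proof. by rewrite discountE mulr0 addr0 invr1. Qed.

Lemma discount_nincr s t : (s <= t)%N -> delta t <= delta s.
Proof.
move=> st; rewrite !discountE lef_pV2 ?posrE ?discount_den_gt0 //.
by rewrite lerD2l ler_pM2l // ler_nat.
Qed.

Lemma discount_le1 t : delta t <= 1.
Proof. by rewrite -discount0 discount_nincr. Qed.

Lemma discount1_lt1 : delta 1%N < 1.
Proof.
by rewrite discountE invf_lt1 ?discount_den_gt0 // ltrDl mulr1.
Qed.

(** Waiting t more periods costs proportionally less after s periods than at once. *)
Lemma discount_supermul s t : delta s * delta t <= delta (s + t).
Proof.
rewrite !discountE -invfM lef_pV2 ?posrE ?mulr_gt0 ?discount_den_gt0 //.
have -> : (1 + beta * s%:R) * (1 + beta * t%:R) =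
          1 + beta * (s + t)%:R + (beta * s%:R) * (beta * t%:R).
  by rewrite natrD; ring.
by rewrite lerDl !mulr_ge0 // ltW.
Qed.

Lemma discount_cvg0 : delta t @[t --> \oo] --> (0 : R).
Proof.
apply/cvgrPdist_le => e e0; near=> t.
rewrite sub0r normrN ger0_norm ?discount_ge0 // discountE.
rewrite -[leRHS]invrK lef_pV2 ?posrE ?invr_gt0 ?discount_den_gt0 //.
rewrite (@le_trans _ _ (beta * t%:R)) ?lerDr //.
rewrite mulrC -ler_pdivrMr // ltW //.
near: t; exact: nbhs_infty_gtr.
Unshelve. all: by end_near. Qed.

End discount_facts.

Lemma discount_antitone {R : realType} (b1 b2 : R) t :
  0 < b1 -> b1 <= b2 -> discount b2 t <= discount b1 t.
Proof.
move=> b10 b12; have b20 := lt_le_trans b10 b12.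
rewrite !discountE lef_pV2 ?posrE ?discount_den_gt0 //.
by rewrite lerD2l ler_wpM2r.
Qed.

(** * First-passage values *)

Section first_passage.
Context {R : realType}.
Variable p : R.

(** [fpv beta n t k] is the expectation of the discount factor at the time at
    which a walk started in k at time t reaches 0, restricted to the event that
    this takes at most n steps; it is given by its dynamic programming
    equation. *)
Fixpoint fpv (beta : R) (n t k : nat) : R :=
  match k with
  | 0 => discount beta t
  | k'.+1 => if n is n'.+1 then
      p * fpv beta n' t.+1 k'.+2 + (1 - p) * fpv beta n' t.+1 k' else 0
  end.

(** The first-passage value [pv beta t k] has no restriction on the number of
    steps. *)
Definition pv (beta : R) (t k : nat) : R := limn (fun n => fpv beta n t k).

Hypotheses (p0 : 0 < p) (p1 : p < 1).

Let p0' : 0 <= p. Proof. exact: ltW. Qed.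
Let q0 : 0 < 1 - p. Proof. by rewrite subr_gt0. Qed.
Let q0' : 0 <= 1 - p. Proof. exact: ltW. Qed.

Let mix_le (a b c : R) : a <= c -> b <= c -> p * a + (1 - p) * b <= c.
Proof.
move=> /(ler_wpM2l p0') ac /(ler_wpM2l q0') bc.
by apply: le_trans (lerD ac bc) _; rewrite -mulrDl addrC subrK mul1r.
Qed.

Lemma fpv0r beta n t : fpv beta n t 0 = discount beta t.
Proof. by case: n. Qed.

Section one_discount.
Variables (beta : R) (beta0 : 0 < beta).

Lemma fpv_ge0 n t k : 0 <= fpv beta n t k.
Proof.
elim: n t k => [|n IH] t [|k] /=; rewrite ?discount_ge0 //.
by rewrite addr_ge0 // mulr_ge0.
Qed.

Lemma fpv_le n t k : fpv beta n t k <= discount beta t.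
Proof.
elim: n t k => [|n IH] t [|k] //=; rewrite ?discount_ge0 //.
have H : discount beta t.+1 <= discount beta t by rewrite discount_nincr.
by rewrite mix_le // (le_trans (IH _ _)).
Qed.

Lemma fpv_leS n t k : fpv beta n t k.+1 <= discount beta t.+1.
Proof.
case: n => [|n] /=; first exact: discount_ge0.
by rewrite mix_le // fpv_le.
Qed.

Lemma fpv_nondecr n t k : fpv beta n t k <= fpv beta n.+1 t k.
Proof.
elim: n t k => [|n IH] t [|k] //=.
  by rewrite addr_ge0 // mulr_ge0 // ?fpv_ge0 // -/(fpv _ 0%N _ k) fpv_ge0.
have := IH t.+1 k.+2; have := IH t.+1 k; rewrite /= => H1 H2.
by rewrite lerD // ler_wpM2l.
Qed.

Lemma fpv_supermul n t s k :
  discount beta t * fpv beta n s k <= fpv beta n (t + s) k.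
Proof.
elim: n s k => [|n IH] s [|k] /=; rewrite ?mulr0 ?discount_supermul //.
rewrite mulrDr !(mulrCA (discount beta t)) -addnS.
by rewrite lerD // ler_wpM2l.
Qed.

(** The probability of ever reaching 0 from k is the minimum of 1 and
    ((1 - p) / p)^k. *)
Lemma fpv_le_ruin n t k : fpv beta n t k <= ((1 - p) / p) ^+ k.
Proof.
have r0 : 0 <= (1 - p) / p by rewrite divr_ge0.
elim: n t k => [|n IH] t [|k] /=; rewrite ?expr0 ?discount_le1 ?exprn_ge0 //.
have /(ler_wpM2l p0') := IH t.+1 k.+2; have /(ler_wpM2l q0') := IH t.+1 k.
have -> : ((1 - p) / p) ^+ k.+1 =
   p * ((1 - p) / p) ^+ k.+2 + (1 - p) * ((1 - p) / p) ^+ k.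
  rewrite !exprS; field; exact: lt0r_neq0.
lra.
Qed.

Lemma fpv_homo t k : {homo (fun n => fpv beta n t k) : n m / (n <= m)%N >-> n <= m}.
Proof. by apply/nondecreasing_seqP => n; exact: fpv_nondecr. Qed.

Lemma pv_cvg t k : fpv beta n t k @[n --> \oo] --> pv beta t k.
Proof.
apply: nondecreasing_is_cvgn; first exact: fpv_homo.
by exists (discount beta t) => _ [n _ <-]; exact: fpv_le.
Qed.

Lemma fpv_le_pv n t k : fpv beta n t k <= pv beta t k.
Proof.
apply: (nondecreasing_cvgn_le (fpv_homo t k)).
by apply/cvg_ex; exists (pv beta t k); exact: pv_cvg.
Qed.

Lemma pv_le_ub t k c : (forall n, fpv beta n t k <= c) -> pv beta t k <= c.
Proof.
move=> H; apply: limr_le; last by near=> n; exact: H.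
by apply/cvg_ex; exists (pv beta t k); exact: pv_cvg.
Unshelve. all: by end_near. Qed.

Lemma pv_ge0 t k : 0 <= pv beta t k.
Proof. exact: le_trans (fpv_ge0 0 t k) (fpv_le_pv _ _ _). Qed.

Lemma pv0r t : pv beta t 0 = discount beta t.
Proof.
apply/le_anti; rewrite pv_le_ub => [|n]; last by rewrite fpv_le.
by rewrite -(fpv0r beta 0 t) fpv_le_pv.
Qed.

Lemma pv_le t k : pv beta t k <= discount beta t.
Proof. by apply: pv_le_ub => n; exact: fpv_le. Qed.

Lemma pv_step t k :
  pv beta t k.+1 = p * pv beta t.+1 k.+2 + (1 - p) * pv beta t.+1 k.
Proof.
have H : fpv beta n.+1 t k.+1 @[n --> \oo] -->
    p * pv beta t.+1 k.+2 + (1 - p) * pv beta t.+1 k.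
  rewrite /=; apply: cvgD; apply: cvgMr; exact: pv_cvg.
have H' : fpv beta n.+1 t k.+1 @[n --> \oo] --> pv beta t k.+1.
  by rewrite (cvg_shiftS (fun n => fpv beta n t k.+1)); exact: pv_cvg.
by rewrite -(cvg_lim _ H') // (cvg_lim _ H).
Qed.

Lemma pv_supermul t s k : discount beta t * pv beta s k <= pv beta (t + s) k.
Proof.
rewrite -ler_pdivlMl ?discount_gt0 //; apply: pv_le_ub => n.
rewrite ler_pdivlMl ?discount_gt0 //.
exact: le_trans (fpv_supermul _ _ _ _) (fpv_le_pv _ _ _).
Qed.

(** Among the nonnegative functions that satisfy the dynamic programming
    equation, the first-passage value is minimal. *)
Lemma pv_minimal (b : nat -> nat -> R) (L : R) :
  0 <= L ->
  (forall t k, 0 <= b t k) -> (forall t, L * discount beta t <= b t 0%N) ->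
  (forall t k, b t k.+1 = p * b t.+1 k.+2 + (1 - p) * b t.+1 k) ->
  forall t k, L * pv beta t k <= b t k.
Proof.
move=> L0 b0 bd bS.
have fb n : forall t k, L * fpv beta n t k <= b t k.
  elim: n => [|n IH] t [|k] /=; rewrite ?mulr0 //.
  rewrite mulrDr !(mulrCA L) bS.
  by apply: lerD; apply: ler_wpM2l.
move=> t k; move: L0; rewrite le_eqVlt => /predU1P[<-|L0]; first by rewrite mul0r.
by rewrite -ler_pdivlMl //; apply: pv_le_ub => n; rewrite ler_pdivlMl.
Qed.

(** To come down k levels, a walk comes down one level k times; by
    [discount_supermul], treating these descents as if each began at time 0 only
    lowers the discount factor. *)
Lemma pv_ge_expr t k : discount beta t * pv beta 0 1 ^+ k <= pv beta t k.
Proof.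
have H j : pv beta 0 1 ^+ j <= pv beta 0 j.
  elim: j => [|j IH]; first by rewrite expr0 pv0r discount0.
  apply: (@le_trans _ _ (pv beta 0 1 * pv beta 0 j)).
    by rewrite exprS ler_wpM2l ?pv_ge0.
  apply: (@pv_minimal (fun t k => pv beta t k.+1)) => [|t' k'|t'|t' k'].
  - exact: pv_ge0.
  - exact: pv_ge0.
  - by have := pv_supermul t' 0 1; rewrite addn0 mulrC.
  - exact: pv_step.
rewrite -[in leRHS](addn0 t); apply: le_trans (pv_supermul t 0 k).
by rewrite ler_wpM2l ?discount_ge0.
Qed.

Lemma pv01_lt1 : pv beta 0 1 < 1.
Proof.
apply: le_lt_trans (discount1_lt1 beta0).
by apply: pv_le_ub => n; exact: fpv_leS.
Qed.

Lemma pv01_gt0 : 0 < pv beta 0 1.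
Proof.
apply: lt_le_trans (fpv_le_pv 1 0 1) => /=.
by rewrite mulr0 add0r mulr_gt0 // discount_gt0.
Qed.

Lemma pv01_le_ruin : p * pv beta 0 1 <= 1 - p.
Proof.
rewrite -ler_pdivlMl // mulrC; apply: pv_le_ub => n.
by have := fpv_le_ruin n 0 1; rewrite expr1.
Qed.

End one_discount.

Lemma pv_antitone (b1 b2 : R) t k : 0 < b1 -> b1 <= b2 -> pv b2 t k <= pv b1 t k.
Proof.
move=> b10 b12; have b20 := lt_le_trans b10 b12.
rewrite -[leLHS]mul1r; apply: (@pv_minimal b2 b20 (pv b1)) => [||t'|t' k'] //.
- exact: pv_ge0.
- by rewrite mul1r pv0r // discount_antitone.
- exact: pv_step.
Qed.

End first_passage.

(** * The state space and the threshold *)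

Section states.
Context {R : realType}.
Variables (u : R) (u1 : 1 < u).

Let u0 : 0 < u. Proof. exact: lt_trans u1. Qed.
Let un0 : u != 0. Proof. exact: lt0r_neq0. Qed.

Lemma states_gt0 x : states u x -> 0 < x.
Proof. by move=> [k _ <-]; exact: exprz_gt0. Qed.

Lemma states_mulz (k : int) x : states u x -> states u (u ^ k * x).
Proof. by move=> [j _ <-]; exists (k + j) => //; rewrite expfzDr. Qed.

Lemma states_level x y : states u x -> states u y -> exists k : int, x = u ^ k * y.
Proof.
move=> [i _ <-] [j _ <-]; exists (i - j).
by rewrite -expfzDr // subrK.
Qed.

Lemma level_inj y : 0 < y -> injective (fun k : int => u ^ k * y).
Proof.
move=> y0 a b /(mulIf (lt0r_neq0 y0)).
by apply: ieexprIz => //; rewrite gt_eqF.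
Qed.

Lemma ler_level y (k : int) : 0 < y -> (u ^ k * y <= y) = (k <= 0).
Proof.
by move=> y0; rewrite ger_pMl // -(expr0z u) ler_eXz2l.
Qed.

Lemma halfline_above x y : states u x -> states u y ->
  ~ (`]0, y]%classic `&` states u) x -> exists m, x = u ^+ m.+1 * y.
Proof.
move=> sx sy nT; have [k xk] := states_level sx sy.
have nk : ~~ (k <= 0).
  apply/negP => k0; apply: nT; split => //=.
  by rewrite in_itv /= (states_gt0 sx) xk ler_level ?(states_gt0 sy).
by case: k xk nk => [[|m]|m] // -> _; exists m.
Qed.

Lemma geometric_unbounded (c : R) : exists n : nat, c <= u ^+ n.
Proof.
have bern n : 1 + n%:R * (u - 1) <= u ^+ n.
  elim: n => [|n IH]; first by rewrite mul0r addr0 expr0.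
  have un : 1 <= u ^+ n by rewrite exprn_ege1 // ltW.
  have /(ler_wpM2l (ltW u0)) := IH; rewrite exprS -natr1; apply: le_trans.
  have : 0 <= n%:R * ((u - 1) * (u - 1)) by rewrite mulr_ge0 // sqr_ge0.
  lra.
exists (Num.bound (`|c| / (u - 1))); apply: le_trans (bern _).
have uu : 0 < u - 1 by rewrite subr_gt0.
have : `|c| / (u - 1) < (Num.bound (`|c| / (u - 1)))%:R.
  by apply: archi_boundP; rewrite divr_ge0 // ltW.
rewrite ltr_pdivrMr // => /ltW H; apply: le_trans (ler_norm _) (le_trans H _).
by rewrite lerDr.
Qed.

Lemma states_small (c y : R) : 0 < c -> 0 < y -> exists n : nat, y <= u ^+ n * c.
Proof.
move=> c0 y0; have [n Hn] := geometric_unbounded (y / c).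
by exists n; rewrite -ler_pdivrMr.
Qed.

(** A half-line of positive reals contains a least state. *)
Lemma set_min_states (c : R) : 0 < c ->
  let y := set_min (`[c, +oo[ `&` states u) in
  [/\ states u y, c <= y & forall x, states u x -> c <= x -> y <= x].
Proof.
move=> c0 y; set A := `[c, +oo[ `&` states u.
have [m Hm] := states_small c0 ltr01.
have [n Hn] := geometric_unbounded (c * u ^+ m).
(* the states c <= x are the u ^ (k - m) with k a natural number *)
pose P k := c <= u ^ (k%:Z - m%:Z).
have exP : exists k, P k.
  exists n; rewrite /P expfzDr // -exprnN -exprnP ler_pdivlMr //.
  exact: exprn_gt0.
case: (ex_minnP exP) => k Pk kmin.
have Amin : (A `&` lbound A) (u ^ (k%:Z - m%:Z)).
  split=> [|x [/= cx [j _ jx]]].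
    by split; [rewrite /= in_itv /= andbT; exact: Pk | exists (k%:Z - m%:Z)].
  rewrite in_itv /= andbT -jx in cx; rewrite -jx ler_eXz2l // lerBlDr.
  have [jm|jm] := leP 0 (j + m%:Z).
    rewrite -[_ + _]gez0_abs // lez_nat; apply: kmin.
    by rewrite /P gez0_abs // addrK.
  suff : u ^ j < c by rewrite ltNge cx.
  have : u ^ (j + m%:Z) < 1 by rewrite -(expr0z u) ltr_eXz2l.
  rewrite expfzDr // -exprnP => H.
  by rewrite -(ltr_pM2r (exprn_gt0 m u0)) (lt_le_trans H) // mulrC.
have : (A `&` lbound A) y by rewrite /y /set_min; case: xgetP => // /(_ _ Amin).
move=> [[/= cy ysts] ymin]; rewrite in_itv /= andbT in cy; split => // x sx cx.
by apply: ymin; split => //=; rewrite in_itv /= cx.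
Qed.

End states.

Section threshold_inequalities.
Context {R : realType}.
Variables (u a K : R).
Hypotheses (u1 : 1 < u) (a0 : 0 < a) (a1 : a < 1) (K0 : 0 < K).

(** Convexity of m |-> (1 - a) u^m + (u - 1) a^m, which takes the value u - a at
    both 0 and 1. *)
Lemma threshold_convex m : u - a <= (1 - a) * u ^+ m + (u - 1) * a ^+ m.
Proof.
elim: m => [|m IH]; first by rewrite !expr0; lra.
have um : 1 <= u ^+ m by rewrite exprn_ege1 // ltW.
have am : a ^+ m <= 1 by rewrite exprn_ile1 // ltW.
have am0 : 0 <= a ^+ m by rewrite exprn_ge0 // ltW.
rewrite !exprS; apply: le_trans IH _.
rewrite -subr_ge0 (_ : _ - _ = (u - 1) * (1 - a) * (u ^+ m - a ^+ m)); last by ring.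
by rewrite !mulr_ge0 // subr_ge0 ?(le_trans am) //; apply: ltW.
Qed.

(** Above the threshold, waiting for y is worth at least as much as stopping. *)
Lemma above_threshold y m : (1 - a) / (u - a) * K <= y -> y <= K ->
  Num.max (K - u ^+ m * y) 0 <= a ^+ m * (K - y).
Proof.
move=> cy yK; have ua : 0 < u - a by rewrite subr_gt0 (lt_trans a1).
have am0 : 0 <= a ^+ m by rewrite exprn_ge0 // ltW.
rewrite ge_max; apply/andP; split; last by rewrite mulr_ge0 // subr_ge0.
have um : 1 <= u ^+ m by rewrite exprn_ege1 // ltW.
have am : a ^+ m <= 1 by rewrite exprn_ile1 // ltW.
have Hc := threshold_convex m.
rewrite mulrAC ler_pdivrMr // in cy.
have H1 : (1 - a) * K * (u ^+ m - a ^+ m) <= y * (u - a) * (u ^+ m - a ^+ m).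
  by rewrite ler_wpM2r // subr_ge0 (le_trans am).
have H2 : K * ((1 - a ^+ m) * (u - a)) <= K * ((1 - a) * (u ^+ m - a ^+ m)).
  rewrite ler_wpM2l ?(ltW K0) // -subr_ge0.
  rewrite (_ : _ - _ = (1 - a) * u ^+ m + (u - 1) * a ^+ m - (u - a)); last by ring.
  by rewrite subr_ge0.
rewrite -subr_ge0 -(pmulr_lge0 _ ua).
have : K * ((1 - a ^+ m) * (u - a)) <= y * (u - a) * (u ^+ m - a ^+ m).
  by apply: le_trans H2 _; rewrite mulrA (mulrC K).
rewrite -subr_ge0 => /le_trans; apply; rewrite le_eqVlt; apply/orP; left; apply/eqP.
by ring.
Qed.

(** Below the threshold, stopping is worth more than waiting for the next lower
    state y. *)
Lemma below_threshold y : y < (1 - a) / (u - a) * K -> a * (K - y) < K - u * y.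
Proof.
have ua : 0 < u - a by rewrite subr_gt0 (lt_trans a1).
by rewrite mulrAC ltr_pdivlMr // => H; nra.
Qed.

(** The excess over the value of waiting for y of stopping m levels above y is
    at most a multiple of 1 - a^m. *)
Lemma excess_bound y m : 0 < y -> a * (K - y) < K - u * y ->
  Num.max (K - u ^+ m * y) 0 <=
    (K - y) * a ^+ m + (K - u * y - a * (K - y)) / (1 - a) * (1 - a ^+ m).
Proof.
move=> y0 H; have b0 : 0 < 1 - a by rewrite subr_gt0.
have am0 : 0 <= a ^+ m by rewrite exprn_ge0 // ltW.
have am : a ^+ m <= 1 by rewrite exprn_ile1 // ltW.
have uy : 0 <= (u - 1) * y by apply: mulr_ge0; rewrite ?subr_ge0 ltW.
have Ky : 0 <= K - y.
  rewrite -(pmulr_lge0 _ b0); apply: le_trans uy _.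
  by rewrite -subr_ge0 (_ : _ - _ = K - u * y - a * (K - y)) ?subr_ge0 ?ltW //; ring.
rewrite ge_max; apply/andP; split; last first.
  apply: addr_ge0; first by rewrite mulr_ge0.
  apply: mulr_ge0; last by rewrite subr_ge0.
  by rewrite divr_ge0 ?(ltW b0) // subr_ge0 ltW.
have Hc := threshold_convex m.
rewrite -subr_ge0.
have -> : (K - y) * a ^+ m + (K - u * y - a * (K - y)) / (1 - a) * (1 - a ^+ m) -
    (K - u ^+ m * y) =
    y * ((1 - a) * u ^+ m + (u - 1) * a ^+ m - (u - a)) / (1 - a).
  by field; exact: lt0r_neq0.
by rewrite divr_ge0 ?(ltW b0) // mulr_ge0 ?subr_ge0 // ltW.
Qed.

End threshold_inequalities.

(** * Functions of the past *)

(** [Z] is a function of the first n + 1 values of the process. *)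
Definition determined {Omega E A : Type} (Y : nat -> Omega -> E) (n : nat)
    (Z : Omega -> A) : Prop :=
  forall w w', (forall s, (s <= n)%N -> Y s w = Y s w') -> Z w = Z w'.

(** Stopping times, with the sigma-algebra of the past replaced by the algebra
    of all functions of the past. *)
Definition determined_time {Omega E : Type} (Y : nat -> Omega -> E)
    (tau : Omega -> option nat) : Prop :=
  forall t, determined Y t (fun w => xle (tau w) (Some t)).

Section determined.
Context {Omega E : Type}.
Implicit Types (Y : nat -> Omega -> E) (tau sigma : Omega -> option nat).

Lemma determined_time_Some Y tau n w w' : determined_time Y tau ->
  (forall s, (s <= n)%N -> Y s w = Y s w') -> xle (tau w) (Some n) ->
  tau w' = tau w.
Proof.
move=> dt ww' tn.
have agree t : (t <= n)%N -> xle (tau w) (Some t) = xle (tau w') (Some t).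
  by move=> tn'; apply: dt => s st; apply/ww'/(leq_trans st).
have := agree n (leqnn n); rewrite tn.
move: tn agree; case: (tau w) => [a|] //= an; case: (tau w') => [b|] //= agree.
move=> /esym bn; congr Some; apply/eqP; rewrite eqn_leq.
by rewrite agree // leqnn -agree // leqnn.
Qed.

(** An event of the natural filtration depends on the past only. *)
Lemma stopping_time_determined (X : nat -> Omega -> E) tau :
  stopping_time X tau -> determined_time X tau.
Proof.
move=> st t w w' ww'.
suff H : natural_filtration X t `<=`
    [set B | forall w w', (forall s, (s <= t)%N -> X s w = X s w') -> B w -> B w'].
  by apply/idP/idP; apply: (H _ (st t)) => // s /ww'.
apply: smallest_sub; last first.
  by move=> _ [s [A [st' ->]]] v v' vv'; rewrite /preimage /= vv'.
split => //.
- by move=> A HA; rewrite setTD => v v' vv' /= nA /(HA v' v) H; apply: nA; apply: H => s /vv'.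
- by move=> F HF v v' vv' [i _ Fi]; exists i => //; exact: HF Fi.
Qed.

Lemma xinf_le (A : set nat) t :
  xle (xinf A) (Some t) <-> exists2 s, (s <= t)%N & A s.
Proof.
rewrite /xinf; case: pselect => [exA|nA] /=.
  case: ex_minnP => m /asboolP Am Hm; split=> [mt|[s st As]]; first by exists m.
  by apply: leq_trans st; apply/Hm/asboolP.
by split=> // -[s _ As]; case: nA; exists s; apply/asboolP.
Qed.

Lemma xinf_Some (A : set nat) s :
  xinf A = Some s -> A s /\ forall r, A r -> (s <= r)%N.
Proof.
rewrite /xinf; case: pselect => // exA [<-].
by case: ex_minnP => m /asboolP Am Hm; split=> // r /asboolP /Hm.
Qed.

Lemma xinf_eqSome (A : set nat) s :
  A s -> (forall r, A r -> (s <= r)%N) -> xinf A = Some s.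
Proof.
move=> As Hs; have /xinf_le : exists2 s', (s' <= s)%N & A s' by exists s.
case E' : (xinf A) => [m|] //= ms; congr Some; apply/eqP.
by have [Am _] := xinf_Some E'; rewrite eqn_leq ms Hs.
Qed.

Lemma xinf_None (A : set nat) : (forall r, ~ A r) -> xinf A = None.
Proof.
move=> H; case E' : (xinf A) => [m|] //.
by have [/H] := xinf_Some E'.
Qed.

Lemma xle_antisub (A B : set nat) : A `<=` B -> xle (xinf B) (xinf A).
Proof.
move=> AB; case E' : (xinf A) => [m|]; last by case: (xinf B).
by apply/xinf_le; exists m => //; apply: AB; case: (xinf_Some E').
Qed.

Lemma xle_refl s : xle s s. Proof. by case: s => /=. Qed.

Lemma xle_trans s t r : xle s t -> xle t r -> xle s r.
Proof. by case: s t r => [a|] [b|] [c|] //=; exact: leq_trans. Qed.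

Lemma determined_time_hit Y (S : set E) : determined_time Y (hit Y S).
Proof.
move=> t w w' ww'; apply/idP/idP => /xinf_le [s st]; rewrite /= => Ss.
  by apply/xinf_le; exists s => //=; rewrite -ww'.
by apply/xinf_le; exists s => //=; rewrite ww'.
Qed.

Lemma stopping_time_hit_pos Y (S : set E) : stopping_time Y (hit_pos Y S).
Proof.
move=> t.
have -> : [set w | xle (hit_pos Y S w) (Some t)] =
   \bigcup_s (if (0 < s <= t)%N then Y s @^-1` S else set0).
  apply/seteqP; split => w /=.
    move=> /xinf_le [s st [s0 Ss]]; exists s => //; by rewrite s0 st.
  move=> [s _]; case: ifP => // /andP[s0 st] Ss.
  by apply/xinf_le; exists s.
rewrite /natural_filtration; apply: sigma_algebra_bigcup => s.
case: ifP => [/andP[_ st]|_]; last exact: sigma_algebra0.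
by apply: sub_gen_smallest; exists s, S.
Qed.

(** The earlier of two random times. *)
Definition xmin (s t : option nat) : option nat := if xle s t then s else t.

Lemma xle_xmin s t n :
  xle (xmin s t) (Some n) = xle s (Some n) || xle t (Some n).
Proof. rewrite /xmin; case: s t => [a|] [b|] //=; rewrite ?orbF //; case: ifP => /=; lia. Qed.

Lemma determined_time_xmin Y tau sigma : determined_time Y tau ->
  determined_time Y sigma -> determined_time Y (fun w => xmin (tau w) (sigma w)).
Proof.
by move=> dt ds t w w' ww'; rewrite !xle_xmin (dt t _ _ ww') (ds t _ _ ww').
Qed.

End determined.

(** * Walks on the integers *)

Section walk.
Context {R : realType} {d : measure_display} {Omega : measurableType d}.
Variables (p : R) (Q : probability Omega R) (Y : nat -> Omega -> int).
Hypotheses (p0 : 0 < p) (p1 : p < 1) (hY : integer_walk p Q Y).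

Let mY t (A : set int) : measurable (Y t @^-1` A).
Proof. exact: (proj1 hY). Qed.

(** The past up to n, encoded by a natural number. *)
Let past n w : nat := pickle (mkseq (Y^~ w) n.+1).

Let pastP n w w' :
  past n w = past n w' <-> (forall s, (s <= n)%N -> Y s w = Y s w').
Proof.
split=> [/(pcan_inj pickleK) H s sn|H].
  by have := congr1 (fun v => nth 0 v s) H; rewrite !nth_mkseq.
by congr pickle; apply/eq_in_map => s; rewrite mem_iota /= add0n ltnS => /H.
Qed.

Let past_cyl n w0 : past n @^-1` [set past n w0] =
  [set w | forall s, (s <= n)%N -> Y s w = Y s w0].
Proof. by apply/seteqP; split => w /= /pastP. Qed.

Let measurable_cyl n (x : nat -> int) :
  measurable [set w | forall s, (s <= n)%N -> Y s w = x s].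
Proof.
have -> : [set w | forall s, (s <= n)%N -> Y s w = x s] =
   \bigcap_(s in [set s | (s <= n)%N]) (Y s @^-1` [set x s]) by [].
by apply: bigcap_measurableType => s _; exact: mY.
Qed.

Let measurable_past n k : measurable (past n @^-1` [set k]).
Proof.
case: (pselect (exists w, past n w = k)) => [[w0 <-]|nk].
  by rewrite past_cyl; exact: measurable_cyl.
have -> : past n @^-1` [set k] = set0; last exact: measurable0.
by apply/seteqP; split => // w /= Hw; apply: nk; exists w.
Qed.

Let integral_const (c : R) : (\int[Q]_(w in setT) c%:E = c%:E)%E.
Proof.
rewrite (integral_cst Q measurableT c%:E) -[RHS]mule1.
by congr *%E; exact: probability_setT.
Qed.

(** Since the past takes countably many values, no further condition is needed. *)
Lemma determined_measurable n (B : set Omega) : determined Y n B -> measurable B.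
Proof.
move=> dB; have -> : B = \bigcup_k (if pselect (past n @^-1` [set k] `<=` B)
    then past n @^-1` [set k] else set0).
  apply/seteqP; split => w.
    move=> Bw; exists (past n w) => //; case: pselect => // -[] w' /=.
    by move=> /pastP H; rewrite (dB w' w).
  by move=> [k _]; case: pselect => // H /H.
apply: bigcupT_measurable => k; case: pselect => [?|?].
  exact: measurable_past.
exact: measurable0.
Qed.

Lemma determined_measurable_fun d1 (T : measurableType d1) n (Z : Omega -> T) :
  determined Y n Z -> measurable_fun setT Z.
Proof.
move=> dZ _ A mA; rewrite setTI; apply: (@determined_measurable n) => w w' ww'.
by rewrite /preimage /= (dZ w w').
Qed.

Let bigcup_past n (E : set Omega) : E = \bigcup_k (past n @^-1` [set k] `&` E).
Proof.
apply/seteqP; split => w; first by move=> Ew; exists (past n w).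
by move=> [k _ [_ Ew]].
Qed.

(** The Markov property, integrated against a function of the past. *)
Let integral_step n (Z : Omega -> R) (k : int) (r : R) :
  0 <= r ->
  (forall w, two_point (fun k : int => k + 1) (fun k : int => k - 1) p
     (Y n w) (Y n w + k) = r) ->
  determined Y n Z -> (forall w, 0 <= Z w) ->
  (\int[Q]_(w in [set w | Y n.+1 w = Y n w + k]%R) (Z w)%:E =
   r%:E * \int[Q]_w (Z w)%:E)%E.
Proof.
move=> r0 Hr dZ Z0.
set E := [set w | Y n.+1 w = Y n w + k].
have mZ (D : set Omega) : measurable_fun D (fun w => (Z w)%:E).
  apply: (measurable_funS measurableT) => //.
  apply/measurable_EFinP; exact: determined_measurable_fun dZ.
have mE : measurable E.
  apply: (@determined_measurable n.+1) => w w' ww'.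
  by rewrite /E /= (ww' n.+1) // (ww' n).
have triv (E' : set Omega) :
    trivIset [set: nat] (fun i => past n @^-1` [set i] `&` E').
  by apply: trivIset_setIr; exact: trivIset_preimage1.
rewrite (bigcup_past n E) ge0_integral_bigcup //; first last.
- by move=> w _; rewrite lee_fin.
- by move=> i; apply: measurableI => //; exact: measurable_past.
rewrite -[in RHS](setTI [set: Omega]).
rewrite [in X in (_ * X)%E](bigcup_past n (setT `&` setT)) ge0_integral_bigcup //; first last.
- by move=> w _; rewrite lee_fin.
- by move=> i; rewrite setTI setIT; exact: measurable_past.
rewrite -nneseriesZl; last first.
  by move=> i _; apply: integral_ge0 => w _; rewrite lee_fin.
apply: eq_eseriesr => i _.
case: (pselect (exists w, past n w = i)) => [[w0 <-]|ni]; last first.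
  have -> : past n @^-1` [set i] = set0.
    by apply/seteqP; split => // w /= Hw; apply: ni; exists w.
  by rewrite !set0I !integral_set0 mule0.
set C := past n @^-1` _.
have mC : measurable C by exact: measurable_past.
have ZC (D : set Omega) : measurable D ->
    (\int[Q]_(w in C `&` D) (Z w)%:E = (Z w0)%:E * Q (C `&` D))%E.
  move=> mD; rewrite -integral_cst; last exact: measurableI.
  apply: eq_integral => w; rewrite inE => -[/= Cw _]; congr EFin.
  by apply: dZ; apply/pastP.
rewrite setTI !ZC // muleCA; congr *%E.
rewrite setIT {1}/C past_cyl.
have [_ /(_ n (fun s => if (s <= n)%N then Y s w0 else Y n w0 + k))] := hY.
rewrite leqnn ltnn Hr muleC => HM.
have -> : [set w | forall s, (s <= n)%N -> Y s w = Y s w0] `&` E =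
  [set w | forall s, (s <= n.+1)%N ->
      Y s w = if (s <= n)%N then Y s w0 else Y n w0 + k].
  apply/seteqP; split => w.
    move=> [/= H Ew] s; rewrite leq_eqVlt ltnS => /orP[/eqP ->|sn].
      by rewrite ltnn Ew H.
    by rewrite sn H.
  move=> /= H; split => /=.
    by move=> s sn; rewrite H ?sn // (leq_trans sn).
  by rewrite /E /= H // ltnn H // leqnn.
rewrite HM; congr (_ * Q _)%E.
by rewrite /C past_cyl; apply/seteqP; split => w /= H s sn; have := H s sn; rewrite sn.
Qed.

Let up_set n := [set w | Y n.+1 w = Y n w + 1].
Let down_set n := [set w | Y n.+1 w = Y n w - 1].

Let integral_up n (Z : Omega -> R) : determined Y n Z -> (forall w, 0 <= Z w) ->
  (\int[Q]_(w in up_set n) (Z w)%:E = p%:E * \int[Q]_w (Z w)%:E)%E.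
Proof.
move=> dZ Z0; apply: integral_step => //; first exact: ltW.
by move=> w; rewrite /two_point eqxx.
Qed.

Let integral_down n (Z : Omega -> R) : determined Y n Z -> (forall w, 0 <= Z w) ->
  (\int[Q]_(w in down_set n) (Z w)%:E = (1 - p)%:E * \int[Q]_w (Z w)%:E)%E.
Proof.
move=> dZ Z0; apply: integral_step => //; first by rewrite subr_ge0 ltW.
move=> w; rewrite /two_point eqxx ifF //; apply/negbTE/eqP; lia.
Qed.

Let measurable_up n : measurable (up_set n).
Proof.
apply: (@determined_measurable n.+1) => w w' ww'.
by rewrite /up_set /= (ww' n.+1) // (ww' n).
Qed.

Let measurable_down n : measurable (down_set n).
Proof.
apply: (@determined_measurable n.+1) => w w' ww'.
by rewrite /down_set /= (ww' n.+1) // (ww' n).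
Qed.

Let disj_up_down n : [disjoint up_set n & down_set n].
Proof.
apply/eqP/seteqP; split => // w []; rewrite /up_set /down_set /=; lia.
Qed.

Let prob_jump n : Q (~` (up_set n `|` down_set n)) = 0%E.
Proof.
have d1 : determined Y n (fun=> 1 : R) by [].
have int1 (D : set Omega) : measurable D -> (\int[Q]_(w in D) (1%:E) = Q D)%E.
  by move=> mD; rewrite (integral_cst Q mD 1%E) mul1e.
have Qu : Q (up_set n) = p%:E.
  rewrite -int1 ?integral_up //.
  by rewrite int1 ?probability_setT ?mule1 //; exact: measurableT.
have Qd : Q (down_set n) = (1 - p)%:E.
  rewrite -int1 ?integral_down //.
  by rewrite int1 ?probability_setT ?mule1 //; exact: measurableT.
rewrite probability_setC ?measureU //; last exact: measurableU.
  rewrite [X in (_ - X)%E](_ : _ = 1%E) ?subee //.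
  by apply: etrans (_ : p%:E + (1 - p)%:E = _)%E; [congr adde|rewrite -EFinD addrC subrK].
exact/eqP/disj_up_down.
Qed.

(** Conditioning on the next step of the walk. *)
Lemma integral_next n (G Gu Gd : Omega -> R) :
  determined Y n.+1 G -> determined Y n Gu -> determined Y n Gd ->
  (forall w, 0 <= G w) -> (forall w, 0 <= Gu w) -> (forall w, 0 <= Gd w) ->
  (forall w, Y n.+1 w = Y n w + 1 -> G w = Gu w) ->
  (forall w, Y n.+1 w = Y n w - 1 -> G w = Gd w) ->
  (\int[Q]_w (G w)%:E = \int[Q]_w (p * Gu w + (1 - p) * Gd w)%:E)%E.
Proof.
move=> dG du dd G0 u0 dd0 Hu Hd.
have mE m (Z : Omega -> R) : determined Y m Z ->
    forall D : set Omega, measurable_fun D (fun w => (Z w)%:E).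
  move=> dZ D; apply: (measurable_funS measurableT) => //.
  by apply/measurable_EFinP; exact: determined_measurable_fun dZ.
rewrite (ge0_negligible_integral _ _ _ _ (prob_jump n)) //; first last.
- by move=> w _; rewrite lee_fin.
- exact: mE dG _.
- by apply: measurableC; exact: measurableU.
rewrite setTD setCK ge0_integral_setU //; first last.
- by move=> w _; rewrite lee_fin.
- exact: mE dG _.
under eq_integral => w /set_mem /Hu -> do [].
under [in X in (_ + X)%E]eq_integral => w /set_mem /Hd -> do [].
rewrite integral_up // integral_down //.
under [RHS]eq_integral do rewrite EFinD !EFinM.
have q0 : 0 <= 1 - p by rewrite subr_ge0 ltW.
have p0' : 0 <= p by rewrite ltW.
have pn := p0'; have qn := q0.
rewrite -lee_fin in pn; rewrite -lee_fin in qn.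
rewrite ge0_integralD //; first last.
- apply: (@mE n (fun w => (1 - p) * Gd w)) => w w' /dd ->; by [].
- by move=> w _; rewrite -EFinM lee_fin mulr_ge0.
- apply: (@mE n (fun w => p * Gu w)) => w w' /du ->; by [].
- by move=> w _; rewrite -EFinM lee_fin mulr_ge0.
by rewrite !ge0_integralZl //; first [exact: (mE n) | move=> w _; rewrite lee_fin].
Qed.

(** ** Optional stopping *)

(** The value of [G] at the current time and position, frozen at [tau]. *)
Definition stopped (tau : Omega -> option nat) (G : nat -> int -> R) n w : R :=
  let s := if tau w is Some s then minn s n else n in G s (Y s w).

Lemma determined_stopped tau G n :
  determined_time Y tau -> determined Y n (stopped tau G n).
Proof.
move=> dt w w' ww'; rewrite /stopped.
case: (boolP (xle (tau w) (Some n))) => tn.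
  rewrite (determined_time_Some dt ww' tn).
  by case: (tau w) tn => [s|] //= sn; rewrite (minn_idPl sn) ww'.
have tn' : ~~ xle (tau w') (Some n) by rewrite -(dt n _ _ ww').
have late (o : option nat) : ~~ xle o (Some n) ->
    (if o is Some s then minn s n else n) = n.
  by case: o => [s|] //=; rewrite -ltnNge => /ltnW/minn_idPr.
by rewrite !late // ww'.
Qed.

Section optional_stopping.
Variables (j : int) (tau : Omega -> option nat) (G : nat -> int -> R).
Hypotheses (dtau : determined_time Y tau) (G0 : forall t k, 0 <= G t k).

Let start (F : Omega -> R) w : R := if Y 0%N w == j then F w else 0.

Let determined_start n F : determined Y n F -> determined Y n (start F).
Proof. by move=> dF w w' ww'; rewrite /start ww' // (dF w w'). Qed.

Let start_ge0 F : (forall w, 0 <= F w) -> forall w, 0 <= start F w.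
Proof. by move=> F0 w; rewrite /start; case: ifP. Qed.

Let stopped_ge0 n w : 0 <= stopped tau G n w. Proof. exact: G0. Qed.

Let measurable_start n F : determined Y n F ->
  measurable_fun setT (fun w => (start F w)%:E).
Proof.
move=> /determined_start dF.
by apply/measurable_EFinP; exact: determined_measurable_fun dF.
Qed.

Let integral_startE (F : Omega -> R) :
  (\int[Q]_w (start F w)%:E = \int[Q]_(w in Y 0%N @^-1` [set j]) (F w)%:E)%E.
Proof.
rewrite [RHS]integral_mkcond; apply: eq_integral => w _.
rewrite patchE /start; case: eqP => [e|ne]; first by rewrite mem_set.
by rewrite memNset.
Qed.

Let step n w : R :=
  if xle (tau w) (Some n) then stopped tau G n w
  else p * G n.+1 (Y n w + 1) + (1 - p) * G n.+1 (Y n w - 1).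

Let determined_step n : determined Y n (step n).
Proof.
move=> w w' ww'; rewrite /step (dtau ww') (determined_stopped _ dtau ww').
by rewrite (ww' n).
Qed.

Let step_ge0 n w : 0 <= step n w.
Proof.
rewrite /step; case: ifP => // _.
by rewrite addr_ge0 // mulr_ge0 // ?subr_ge0 // ltW.
Qed.

Let integral_stoppedS n :
  (\int[Q]_w (start (stopped tau G n.+1) w)%:E =
   \int[Q]_w (start (step n) w)%:E)%E.
Proof.
pose H k w := if xle (tau w) (Some n) then stopped tau G n w
  else G n.+1 (Y n w + k).
have dH k : determined Y n (H k).
  move=> w w' ww'; rewrite /H (dtau ww') (determined_stopped _ dtau ww').
  by rewrite (ww' n).
have HE k w : Y n.+1 w = Y n w + k -> stopped tau G n.+1 w = H k w.
  move=> Yk; rewrite /H /stopped; case: (tau w) => [s|] /=; last by rewrite Yk.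
  have [sn|ns] := leqP s n.
    by rewrite (minn_idPl (leqW sn)).
  by rewrite (minn_idPr ns) Yk.
have H0 k w : 0 <= H k w by rewrite /H; case: ifP.
rewrite (@integral_next n _ (start (H 1)) (start (H (-1)))).
- apply: eq_integral => w _; congr EFin; rewrite /start /step /H.
  case: ifP => // _; last by rewrite !mulr0 addr0.
  by case: ifP => // _; rewrite -mulrDl addrC subrK mul1r.
- exact/determined_start/determined_stopped.
- exact: determined_start.
- exact: determined_start.
- exact: start_ge0.
- exact: start_ge0.
- exact: start_ge0.
- by move=> w /HE Hw; rewrite /start Hw.
- by move=> w /HE Hw; rewrite /start Hw.
Qed.

Let integral_stopped0 : (\int[Q]_w (start (stopped tau G 0) w)%:E =
  (G 0%N j)%:E * Q (Y 0%N @^-1` [set j]))%E.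
Proof.
rewrite integral_startE -integral_cst //.
apply: eq_integral => w; rewrite inE /= => Yj.
by rewrite /stopped; case: (tau w) => [s|]; rewrite ?minn0 Yj.
Qed.

Variable e : nat -> R.
Hypotheses (e0 : forall n, 0 <= e n) (ecvg : e n @[n --> \oo] --> (0 : R)).

Let e_small (eps : R) : 0 < eps -> exists n, e n <= eps.
Proof.
move=> eps0; have /cvgrPdist_le/(_ _ eps0)[n _ /(_ n (leqnn n))] := ecvg.
by rewrite sub0r normrN ger0_norm // => H; exists n.
Qed.

Variable F : Omega -> R.
Hypotheses (F0 : forall w, 0 <= F w) (mF : measurable_fun setT F).

Let measurable_startF : measurable_fun setT (fun w => (start F w)%:E).
Proof.
apply/measurable_EFinP; apply: measurable_fun_ifT => //.
apply: (@determined_measurable_fun _ _ 0).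
by move=> w w' ww'; rewrite ww'.
Qed.

Let integral_stopped_addl n (F1 : Omega -> R) : determined Y n F1 ->
  (forall w, 0 <= F1 w) ->
  (\int[Q]_w (start F1 w + e n)%:E = \int[Q]_w (start F1 w)%:E + (e n)%:E)%E.
Proof.
move=> dF1 F10; under eq_integral do rewrite EFinD.
rewrite ge0_integralD //.
- by congr adde; exact: integral_const.
- by move=> w _; rewrite lee_fin start_ge0.
- exact: measurable_start dF1.
- by move=> w _; rewrite lee_fin.
Qed.

(** If [G] is a supermartingale up to [tau] that dominates [F] at [tau], its initial
    value dominates the expectation of [F]. The bound [e] stands in for uniform
    integrability, and no assumption is made on [G] after [tau]. *)
Lemma optional_stopping_le :
  (forall s w, Y 0%N w = j -> tau w = Some s -> F w <= G s (Y s w)) ->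
  (forall n w, Y 0%N w = j -> ~~ xle (tau w) (Some n) -> F w <= e n) ->
  (forall n w, Y 0%N w = j -> ~~ xle (tau w) (Some n) ->
    p * G n.+1 (Y n w + 1) + (1 - p) * G n.+1 (Y n w - 1) <= G n (Y n w)) ->
  (\int[Q]_(w in Y 0%N @^-1` [set j]) (F w)%:E <=
   (G 0%N j)%:E * Q (Y 0%N @^-1` [set j]))%E.
Proof.
move=> FG Fe super.
have decr n : (\int[Q]_w (start (stopped tau G n) w)%:E <=
    (G 0%N j)%:E * Q (Y 0%N @^-1` [set j]))%E.
  elim: n => [|n IH]; first by rewrite integral_stopped0.
  rewrite integral_stoppedS; apply: le_trans IH; apply: ge0_le_integral => //.
  - by move=> w _; rewrite lee_fin start_ge0.
  - exact: measurable_start (@determined_step n).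
  - exact: measurable_start (determined_stopped _ dtau).
  - move=> w _; rewrite lee_fin /start; case: eqP => // Yj.
    rewrite /step; case: ifP => // /negbT tn; apply: le_trans (super _ _ Yj tn) _.
    rewrite /stopped; case: (tau w) tn => [s|] //=.
    by rewrite -ltnNge => /ltnW/minn_idPr ->.
apply/lee_addgt0Pr => eps /e_small[n en].
apply: (@le_trans _ _ (\int[Q]_w (start (stopped tau G n) w)%:E + (e n)%:E)%E);
  last by apply: leeD => //; rewrite lee_fin.
rewrite -integral_startE -integral_stopped_addl //; last exact: determined_stopped.
apply: ge0_le_integral => //.
- by move=> w _; rewrite lee_fin start_ge0.
- apply: (@measurableT_comp _ _ _ _ _ _ EFin) => //; apply: measurable_funD => //.
  by apply/measurable_EFinP; exact: measurable_start (determined_stopped _ dtau).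
- move=> w _; rewrite lee_fin /start; case: eqP => [Yj|_]; last by rewrite add0r.
  case: (boolP (xle (tau w) (Some n))) => tn; last first.
    by apply: le_trans (Fe _ _ Yj tn) _; rewrite lerDr.
  case E : (tau w) tn => [s|] //= sn; apply: le_trans (FG _ _ Yj E) _.
  by rewrite /stopped E (minn_idPl sn) lerDl.
Qed.

(** The same for submartingales. *)
Lemma optional_stopping_ge :
  (forall s w, Y 0%N w = j -> tau w = Some s -> G s (Y s w) <= F w) ->
  (forall n w, Y 0%N w = j -> ~~ xle (tau w) (Some n) -> G n (Y n w) <= e n) ->
  (forall n w, Y 0%N w = j -> ~~ xle (tau w) (Some n) ->
    G n (Y n w) <= p * G n.+1 (Y n w + 1) + (1 - p) * G n.+1 (Y n w - 1)) ->
  ((G 0%N j)%:E * Q (Y 0%N @^-1` [set j]) <=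
   \int[Q]_(w in Y 0%N @^-1` [set j]) (F w)%:E)%E.
Proof.
move=> GF Ge sub.
have incr n : ((G 0%N j)%:E * Q (Y 0%N @^-1` [set j]) <=
    \int[Q]_w (start (stopped tau G n) w)%:E)%E.
  elim: n => [|n IH]; first by rewrite integral_stopped0.
  rewrite integral_stoppedS; apply: le_trans IH _; apply: ge0_le_integral => //.
  - by move=> w _; rewrite lee_fin start_ge0.
  - exact: measurable_start (determined_stopped _ dtau).
  - exact: measurable_start (@determined_step n).
  - move=> w _; rewrite lee_fin /start; case: eqP => // Yj.
    rewrite /step; case: ifP => // /negbT tn; apply: le_trans (sub _ _ Yj tn).
    rewrite /stopped; case: (tau w) tn => [s|] //=.
    by rewrite -ltnNge => /ltnW/minn_idPr ->.
apply/lee_addgt0Pr => eps /e_small[n en].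
apply: le_trans (incr n) _; rewrite -integral_startE.
apply: (@le_trans _ _ (\int[Q]_w (start F w)%:E + (e n)%:E)%E);
  last by apply: leeD => //; rewrite lee_fin.
have -> : (\int[Q]_w (start F w)%:E + (e n)%:E =
    \int[Q]_w (start F w + e n)%:E)%E.
  under [RHS]eq_integral do rewrite EFinD.
  rewrite ge0_integralD //.
  - by congr adde; rewrite integral_const.
  - by move=> w _; rewrite lee_fin start_ge0.
  - by move=> w _; rewrite lee_fin.
apply: ge0_le_integral => //.
- by move=> w _; rewrite lee_fin start_ge0.
- exact: measurable_start (determined_stopped _ dtau).
- apply: (@measurableT_comp _ _ _ _ _ _ EFin) => //; apply: measurable_funD => //.
  exact/measurable_EFinP.
- move=> w _; rewrite lee_fin /start; case: eqP => [Yj|_]; last by rewrite add0r.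
  case: (boolP (xle (tau w) (Some n))) => tn; last first.
    apply: (@le_trans _ _ (e n)); last by rewrite lerDr.
    apply: le_trans (Ge _ _ Yj tn).
    rewrite /stopped; case: (tau w) tn => [s|] //=.
    by rewrite -ltnNge => /ltnW/minn_idPr ->.
  case E : (tau w) tn => [s|] //= sn; rewrite /stopped E (minn_idPl sn).
  by apply: le_trans (GF _ _ Yj E) _; rewrite lerDl.
Qed.

End optional_stopping.

End walk.

(** * Functionals of the walk *)

(** Extends a function of a level in the natural numbers to the negative levels,
    by a value that depends on time only. *)
Definition extend {R : Type} (b : nat -> R) (g : nat -> nat -> R)
    (t : nat) (k : int) : R :=
  if k is Posz m then g t m else b t.

Lemma extend_step {R : realType} (p : R) b g t m :
  p * extend b g t.+1 (m.+1%:Z + 1) + (1 - p) * extend b g t.+1 (m.+1%:Z - 1) =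
  p * g t.+1 m.+2 + (1 - p) * g t.+1 m.
Proof.
have -> : m.+1%:Z + 1 = m.+2%:Z by lia.
by have -> : m.+1%:Z - 1 = m%:Z by lia.
Qed.

Section walk_functionals.
Context {R : realType} {d : measure_display} {Omega : measurableType d}.
Variables (p : R) (Q : probability Omega R) (Y : nat -> Omega -> int).
Hypotheses (p0 : 0 < p) (p1 : p < 1) (hY : integer_walk p Q Y).

(** A function that is determined by the past at [tau], and constant when [tau] is
    infinite. *)
Lemma stopped_measurable (tau : Omega -> option nat) (F : Omega -> R) (c : R) :
  determined_time Y tau ->
  (forall n, determined Y n (fun w => if xle (tau w) (Some n) then F w else c)) ->
  (forall w, tau w = None -> F w = c) -> measurable_fun setT F.
Proof.
move=> dt dF Fc.
apply: (@measurable_fun_cvg _ _ _ _ (fun n w => if xle (tau w) (Some n) then F w else c)).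
  by move=> n; exact: (determined_measurable_fun hY (dF n)).
move=> w _; apply: cvg_near_cst.
case E : (tau w) => [s|]; last by rewrite (Fc _ E); near=> n.
by near=> n; rewrite /= ifT //; near: n; exact: nbhs_infty_ge.
Unshelve. all: by end_near. Qed.

(** The conditional expectation in the threshold is a first-passage value. Only
    almost surely does the walk remain nonnegative until it reaches 0, so the upper
    and the lower bound use two different values at negative levels, for which the
    supermartingale and the submartingale property hold there too. *)
Lemma alphaE beta : 0 < beta -> (0 < Q (Y 0%N @^-1` [set 1%:Z]))%E ->
  alpha beta Q Y = pv p beta 0 1.
Proof.
move=> beta0 Q1.
pose F w := if hit Y [set 0] w is Some t then discount beta t else 0.
have dtau : determined_time Y (hit Y [set 0]) by exact: determined_time_hit.
have F0 w : 0 <= F w.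
  by rewrite /F; case: (hit _ _ _) => // t; exact: discount_ge0.
have mF : measurable_fun setT F.
  apply: (@stopped_measurable (hit Y [set 0]) F 0) => //.
    move=> n w w' ww'; rewrite /F (dtau n w w' ww').
    case: ifP => // tn; rewrite (determined_time_Some dtau _ tn) //.
    by move=> s sn; rewrite ww'.
  by move=> w; rewrite /F => ->.
set D := Y 0%N @^-1` [set 1].
have mD : measurable D by exact: (proj1 hY).
have e0 n : 0 <= discount beta n by exact: discount_ge0.
have late n w : ~~ xle (hit Y [set 0] w) (Some n) -> Y n w != 0.
  by apply: contra => /eqP Y0; apply/xinf_le; exists n.
have at0 s w : hit Y [set 0] w = Some s -> Y s w = 0 by move=> /xinf_Some[].
have pvS b t m : p * extend b (pv p beta) t.+1 (m.+1%:Z + 1) +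
    (1 - p) * extend b (pv p beta) t.+1 (m.+1%:Z - 1) = pv p beta t m.+1.
  by rewrite extend_step -pv_step.
have ext0 t k : 0 <= extend (discount beta) (pv p beta) t k.
  by case: k => m /=; rewrite ?pv_ge0 // discount_ge0.
have ext00 t k : 0 <= extend (fun=> 0) (pv p beta) t k.
  by case: k => m /=; rewrite ?pv_ge0.
have int : (\int[Q]_(w in D) (F w)%:E = (pv p beta 0 1)%:E * Q D)%E.
  apply/le_anti/andP; split.
  - apply: (optional_stopping_le p0 p1 hY (j := 1) dtau ext0 e0
      (discount_cvg0 beta0) F0 mF).
    + by move=> s w _ hs; rewrite (at0 _ _ hs) /F hs /= pv0r.
    + move=> n w _ tn; rewrite /F; case: (hit _ _ _) tn => [s|] //=.
      by rewrite -ltnNge => /ltnW/discount_nincr; apply.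
    + move=> n w _ /late; case: (Y n w) => [[|m]|m] // _; first by rewrite pvS.
      have -> : Negz m - 1 = Negz m.+1 by lia.
      have H : discount beta n.+1 <= discount beta n by exact: discount_nincr.
      have -> : extend (discount beta) (pv p beta) n.+1 (Negz m + 1) = discount beta n.+1.
        by case: m => [|m] //=; exact: pv0r.
      by rewrite /= -mulrDl addrC subrK mul1r.
  - apply: (optional_stopping_ge p0 p1 hY (j := 1) dtau ext00 e0
      (discount_cvg0 beta0) F0 mF).
    + by move=> s w _ hs; rewrite (at0 _ _ hs) /F hs /= pv0r.
    + move=> n w _ _; case: (Y n w) => m /=; rewrite ?discount_ge0 //.
      exact: pv_le.
    + move=> n w _ /late; case: (Y n w) => [[|m]|m] // _; first by rewrite pvS.
      by rewrite {1}/extend addr_ge0 // mulr_ge0 // ?subr_ge0 ltW.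
rewrite /alpha /cond_expectation.
have -> : ('E_Q[F \* \1_D] = \int[Q]_(w in D) (F w)%:E)%E.
  rewrite unlock [RHS]integral_mkcond; apply: eq_integral => w _.
  rewrite patchE /= indicE; case: ifP => _; first by rewrite mulr1.
  by rewrite mulr0.
have QD : Q D \is a fin_num by exact: fin_num_measure.
rewrite int fineM // mulfK // gt_eqF // fine_gt0 // Q1 /=.
by rewrite ltey_eq QD.
Qed.

End walk_functionals.

(** * The game *)

Section payoffs.
Context {R : realType} {d : measure_display} {Omega : measurableType d}.
Variables (P : R -> probability Omega R) (X : nat -> Omega -> R) (u p : R).
Hypotheses (u1 : 1 < u) (p0 : 0 < p) (p1 : p < 1).
Hypothesis hX : multiplicative_walk u p P X.

Let u0 : 0 < u. Proof. exact: lt_trans u1. Qed.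
Let un0 : u != 0. Proof. exact: lt0r_neq0. Qed.

(** The levels of the multiplicative walk relative to y form a walk on the
    integers. *)
Lemma level_walk y : states u y -> exists2 Z : nat -> Omega -> int,
  (forall t w, X t w = u ^ Z t w * y) &
  (forall x, states u x -> integer_walk p (P x) Z).
Proof.
move=> sy; have y0 := states_gt0 u1 sy.
have ex t w := states_level u1 (proj1 hX t w) sy.
pose Z t w := sval (cid (ex t w)).
have XZ t w : X t w = u ^ Z t w * y by rewrite /Z; case: cid.
have inj := level_inj u1 y0.
exists Z => // x sx; have [_ [mX HX]] := proj2 hX x sx; split.
  move=> t A.
  have -> : Z t @^-1` A = X t @^-1` [set u ^ k * y | k in A].
    apply/seteqP; split => w /=; first by exists (Z t w).
    by move=> [k Ak]; rewrite XZ => /inj <-.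
  exact: mX.
move=> n z; have := HX n (fun s => u ^ z s * y).
have E m : [set w | forall s, (s <= m)%N -> X s w = u ^ z s * y] =
    [set w | forall s, (s <= m)%N -> Z s w = z s].
  apply/seteqP; split => w /= H s sm; have := H s sm.
    by rewrite XZ => /inj.
  by rewrite XZ => ->.
rewrite !E => ->; congr (_ * (_)%:E)%E; rewrite /two_point.
have -> : (u ^ z n.+1 * y == u * (u ^ z n * y)) = (z n.+1 == z n + 1).
  by rewrite mulrA -[in u * _](expr1z u) -expfzDr // addrC (inj_eq inj).
have -> : (u ^ z n.+1 * y == u ^ z n * y / u) = (z n.+1 == z n - 1).
  by rewrite mulrAC -exprN1 -expfzDr // (inj_eq inj).
by [].
Qed.

Section one_firm.
Variables (K N beta : R) (h : R -> R).
Hypotheses (beta0 : 0 < beta) (KN : K <= N) (N0 : 0 <= N).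
Hypothesis hh : forall x, states u x ->
  concede (firm K N beta h) x <= h x <= yielded_to (firm K N beta h) x.
Local Notation firm := (firm K N beta h).
Local Notation delta := (discount beta).
Local Notation f x := (Num.max (K - x) 0).

Let sX t w : states u (X t w). Proof. exact: (proj1 hX). Qed.

Let f_le_N x : states u x -> f x <= N.
Proof.
move=> /(states_gt0 u1) x0; rewrite ge_max N0 andbT.
by apply: le_trans KN; rewrite gerBl ltW.
Qed.

Let f_ge0 x : 0 <= f x. Proof. by rewrite le_max lexx orbT. Qed.

Let h_ge0 x : states u x -> 0 <= h x.
Proof. by move=> /hh/andP[fh _]; exact: le_trans (f_ge0 x) fh. Qed.

Let h_le_N x : states u x -> h x <= N.
Proof. by move=> /hh/andP[]. Qed.

Let dN_ge0 n : 0 <= N * delta n.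
Proof. by rewrite mulr_ge0 // discount_ge0. Qed.

Let dN_cvg : N * delta n @[n --> \oo] --> (0 : R).
Proof. rewrite -[X in _ --> X](mulr0 N); apply: cvgMr; exact: discount_cvg0. Qed.

(** The limit superior that defines the payoff on the event that nobody stops is a
    limit, as [h] is bounded. *)
Lemma payoff_None tau sigma w : tau w = None -> sigma w = None ->
  payoff X firm tau sigma w = 0.
Proof.
move=> E1 E2; rewrite /payoff E1 E2 /=.
have H : delta t * h (X t w) @[t --> \oo] --> (0 : R).
  apply: (@squeeze_cvgr _ _ _ _ (fun=> 0) (fun t => N * delta t)) => //; last exact: cvg_cst.
  near=> t; rewrite mulr_ge0 ?discount_ge0 ?h_ge0 //= mulrC.
  by rewrite ler_wpM2r ?discount_ge0 // h_le_N.
by have [_] := cvg_limn_inf_sup H.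
Unshelve. all: by end_near. Qed.

Lemma payoff_concede tau sigma w s :
  tau w = Some s -> ~~ xle (sigma w) (Some s) ->
  payoff X firm tau sigma w = delta s * f (X s w).
Proof.
rewrite /payoff => ->; case: (sigma w) => [t|] //=.
by rewrite -ltnNge => ->.
Qed.

Lemma payoff_yielded_to tau sigma w s :
  sigma w = Some s -> ~~ xle (tau w) (Some s) ->
  payoff X firm tau sigma w = delta s * N.
Proof.
rewrite /payoff => ->; case: (tau w) => [t|] //=.
by rewrite -ltnNge => ts; rewrite ts ltnNge (ltnW ts).
Qed.

Lemma payoff_bounds tau sigma w s : xmin (tau w) (sigma w) = Some s ->
  0 <= payoff X firm tau sigma w <= N * delta s.
Proof.
have bnd a : 0 <= a <= N -> 0 <= delta s * a <= N * delta s.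
  move=> /andP[a0 aN]; rewrite mulr_ge0 ?discount_ge0 //= mulrC.
  by rewrite ler_wpM2r ?discount_ge0.
rewrite /payoff /xmin; case: (tau w) (sigma w) => [a|] [b|] //=.
- case: (ltngtP a b) => ab [E]; subst s; apply: bnd => /=.
  + by rewrite f_ge0 f_le_N.
  + by rewrite N0 lexx.
  + by rewrite h_ge0 ?h_le_N.
- by move=> [E]; subst s; apply: bnd; rewrite f_ge0 f_le_N.
- by move=> [E]; subst s; apply: bnd; rewrite N0 lexx.
Qed.

Let payoff_ge0 tau sigma w : 0 <= payoff X firm tau sigma w.
Proof.
case E : (xmin (tau w) (sigma w)) => [s|].
  by have /andP[] := payoff_bounds E.
suff [E1 E2] : tau w = None /\ sigma w = None by rewrite payoff_None.
by move: E; rewrite /xmin; case: (tau w) (sigma w) => [a|] [b|] //=; case: ifP.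
Qed.

Let payoff_late tau sigma w n : ~~ xle (xmin (tau w) (sigma w)) (Some n) ->
  payoff X firm tau sigma w <= N * delta n.
Proof.
case E : (xmin (tau w) (sigma w)) => [s|] /=.
  rewrite -ltnNge => /ltnW ns; have /andP[_ H] := payoff_bounds E.
  by apply: le_trans H _; rewrite ler_wpM2l // discount_nincr.
suff [E1 E2] : tau w = None /\ sigma w = None by rewrite payoff_None.
by move: E; rewrite /xmin; case: (tau w) (sigma w) => [a|] [b|] //=; case: ifP.
Qed.

Let determined_payoff tau sigma n :
  determined_time X tau -> determined_time X sigma ->
  determined X n (fun w => if xle (xmin (tau w) (sigma w)) (Some n)
                           then payoff X firm tau sigma w else 0).
Proof.
move=> dt ds w w' ww'; have dm := determined_time_xmin dt ds.
rewrite (dm n w w' ww'); case: ifP => //.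
rewrite -(dm n w w' ww') xle_xmin.
have late o o' : xle o (Some n) = xle o' (Some n) -> ~~ xle o (Some n) ->
    ~~ xle o' (Some n) by move=> ->.
case: (boolP (xle (tau w) (Some n))) => tn; case: (boolP (xle (sigma w) (Some n))) => sn //= _.
- rewrite /payoff (determined_time_Some dt ww' tn) (determined_time_Some ds ww' sn).
  case: (tau w) tn (sigma w) sn => [a|] // an [b|] // bn.
  by rewrite /= in an bn; rewrite !ww'.
- have sn' := late _ _ (ds n w w' ww') sn.
  case E : (tau w) tn => [a|] // an.
  have E' : tau w' = Some a by rewrite -E (determined_time_Some dt ww') // E.
  have early o : ~~ xle o (Some n) -> ~~ xle o (Some a).
    by apply: contra => oa; exact: xle_trans oa an.
  by rewrite (payoff_concede E (early _ sn)) (payoff_concede E' (early _ sn')) ww'.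
- have tn' := late _ _ (dt n w w' ww') tn.
  case E : (sigma w) sn => [a|] // an.
  have E' : sigma w' = Some a by rewrite -E (determined_time_Some ds ww') // E.
  have early o : ~~ xle o (Some n) -> ~~ xle o (Some a).
    by apply: contra => oa; exact: xle_trans oa an.
  by rewrite (payoff_yielded_to E (early _ tn)) (payoff_yielded_to E' (early _ tn')).
Qed.

Let dhit S : determined_time X (hit X S).
Proof. exact: determined_time_hit. Qed.

Let dhit_pos S : determined_time X (hit_pos X S).
Proof. by apply: stopping_time_determined; exact: stopping_time_hit_pos. Qed.

Section relative_level.
Variables (y : R) (Z : nat -> Omega -> int).
Hypotheses (sy : states u y) (XZ : forall t w, X t w = u ^ Z t w * y).
Hypothesis hZ : forall x, states u x -> integer_walk p (P x) Z.

Let y0 : 0 < y. Proof. exact: states_gt0 sy. Qed.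

Let determinedXZ A n (F : Omega -> A) : determined X n F -> determined Z n F.
Proof. by move=> dF w w' ww'; apply: dF => s sn; rewrite !XZ ww'. Qed.

Let determined_timeXZ tau : determined_time X tau -> determined_time Z tau.
Proof. by move=> dt t; apply: determinedXZ. Qed.

Lemma measurable_payoff tau sigma :
  determined_time X tau -> determined_time X sigma ->
  measurable_fun setT (payoff X firm tau sigma).
Proof.
move=> dt ds; have dm := determined_timeXZ (determined_time_xmin dt ds).
apply: (stopped_measurable (hZ sy) (c := 0) dm).
  by move=> n; apply: determinedXZ; exact: determined_payoff.
by move=> w E; apply: payoff_None; move: E; rewrite /xmin;
  case: (tau w) (sigma w) => [a|] [b|] //=; case: ifP.
Qed.

Section start.
Variable k : int.
Let x := u ^ k * y.
Let D := Z 0%N @^-1` [set k].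

Let sx : states u x. Proof. exact: states_mulz. Qed.

Let startE w : (X 0%N w = x) = (Z 0%N w = k).
Proof.
by apply/propext; rewrite XZ; split=> [/(level_inj u1 y0)|->].
Qed.

Let PD : P x D = 1%E.
Proof.
have [<- _] := proj2 hX x sx; congr (P x _).
by apply/seteqP; split => w; rewrite /D /= -startE.
Qed.

Let J_startE tau sigma : determined_time X tau -> determined_time X sigma ->
  J P X firm x tau sigma = (\int[P x]_(w in D) (payoff X firm tau sigma w)%:E)%E.
Proof.
move=> dt ds; rewrite /J unlock.
have mD : measurable D by exact: (proj1 (hZ sx)).
have mN : measurable (~` D) by exact: measurableC.
have PN : P x (~` D) = 0%E by rewrite probability_setC // PD subee.
rewrite (ge0_negligible_integral mN _ _ _ PN) //.
- by rewrite setTD setCK.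
- apply/measurable_EFinP; exact: measurable_payoff.
- by move=> w _; rewrite lee_fin.
Qed.

(** A payoff that is determined by the initial state. *)
Lemma J_cst tau sigma c : determined_time X tau -> determined_time X sigma ->
  (forall w, X 0%N w = x -> payoff X firm tau sigma w = c) ->
  J P X firm x tau sigma = c%:E.
Proof.
move=> dt ds H; rewrite J_startE // -[RHS]mule1 -PD.
rewrite -integral_cst; last exact: (proj1 (hZ sx)).
by apply: eq_integral => w; rewrite inE /D /= -startE => /H ->.
Qed.

Variables (tau sigma : Omega -> option nat) (G : nat -> int -> R).
Hypotheses (dtau : determined_time X tau) (dsigma : determined_time X sigma).
Hypothesis G0 : forall t m, 0 <= G t m.

Let rho w := xmin (tau w) (sigma w).

Let drho : determined_time Z rho.
Proof. exact/determined_timeXZ/determined_time_xmin. Qed.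

(** Optional stopping for payoffs: [G] bounds the payoff at the first time at which
    a player stops. *)
Lemma J_le :
  (forall s w, X 0%N w = x -> rho w = Some s ->
    payoff X firm tau sigma w <= G s (Z s w)) ->
  (forall n w, X 0%N w = x -> ~~ xle (rho w) (Some n) ->
    p * G n.+1 (Z n w + 1) + (1 - p) * G n.+1 (Z n w - 1) <= G n (Z n w)) ->
  (J P X firm x tau sigma <= (G 0%N k)%:E)%E.
Proof.
move=> FG super; rewrite J_startE // -[leRHS]mule1 -PD.
apply: (optional_stopping_le p0 p1 (hZ sx) drho G0 dN_ge0 dN_cvg) => //.
- exact: measurable_payoff.
- by move=> s w; rewrite -startE; exact: FG.
- by move=> n w _; exact: payoff_late.
- by move=> n w; rewrite -startE; exact: super.
Qed.

Lemma J_ge :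
  (forall s w, X 0%N w = x -> rho w = Some s ->
    G s (Z s w) <= payoff X firm tau sigma w) ->
  (forall n w, G n (Z n w) <= N * delta n) ->
  (forall n w, X 0%N w = x -> ~~ xle (rho w) (Some n) ->
    G n (Z n w) <= p * G n.+1 (Z n w + 1) + (1 - p) * G n.+1 (Z n w - 1)) ->
  ((G 0%N k)%:E <= J P X firm x tau sigma)%E.
Proof.
move=> GF GN sub; rewrite J_startE // -[leLHS]mule1 -PD.
apply: (optional_stopping_ge p0 p1 (hZ sx) drho G0 dN_ge0 dN_cvg) => //.
- exact: measurable_payoff.
- by move=> s w; rewrite -startE; exact: GF.
- by move=> n w; rewrite -startE; exact: sub.
Qed.

End start.

Let T := `]0, y]%classic `&` states u.

Let TE s w : T (X s w) <-> Z s w <= 0.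
Proof.
rewrite /T /= in_itv /= (states_gt0 u1 (sX s w)) /= XZ ler_level //.
by split=> [[]|Zs] //; split=> //; rewrite -XZ.
Qed.

Lemma hit0 w : hit X set0 w = None.
Proof. by apply: xinf_None => r. Qed.

Lemma hit_pos0 w : hit_pos X set0 w = None.
Proof. by apply: xinf_None => r []. Qed.

Let xmin_None o : xmin o None = o. Proof. by case: o. Qed.

Let xmin_Nonel o : xmin None o = o. Proof. by case: o. Qed.

Lemma payoff_alone tau w s : tau w = Some s ->
  payoff X firm tau (hit X set0) w = delta s * f (X s w).
Proof. by move=> E; rewrite (payoff_concede E) // hit0. Qed.

Let start_level m w : X 0%N w = u ^+ m * y -> Z 0%N w = m.
Proof. by rewrite XZ exprnP => /(level_inj u1 y0). Qed.

Let Zpos_pred s w : 0 < Z s w -> exists m, Z s w = m.+1%:Z.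
Proof. by case: (Z s w) => [[|m]|m] // _; exists m. Qed.

Let before_hit n w : ~~ xle (hit X T w) (Some n) -> exists m, Z n w = m.+1%:Z.
Proof.
move=> H; apply: Zpos_pred; rewrite ltNge; apply: contra H => /TE Tn.
by apply/xinf_le; exists n.
Qed.

Let before_hit_pos m n w : X 0%N w = u ^+ m.+1 * y ->
  ~~ xle (hit_pos X T w) (Some n) -> exists m, Z n w = m.+1%:Z.
Proof.
move=> /start_level Z0; case: n => [|n] H; first by exists m.
apply: Zpos_pred; rewrite ltNge; apply: contra H => /TE Tn.
by apply/xinf_le; exists n.+1.
Qed.

Let at_hit_pos s w : hit_pos X T w = Some s -> Z s w <= 0.
Proof. by move=> /xinf_Some[[_ /TE]]. Qed.

Let at_hit s w : hit X T w = Some s -> Z s w <= 0.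
Proof. by move=> /xinf_Some[/TE]. Qed.

Let alpha := pv p beta 0 1.

Let pv_ge t m : delta t * alpha ^+ m <= pv p beta t m.
Proof. exact: pv_ge_expr. Qed.

(** The value of waiting for level 0 to receive r there. The value [b] at negative
    levels is chosen as each bound needs, since almost surely those levels are
    not reached before level 0. *)
Let W (b : nat -> R) (r : R) := extend b (fun t m => r * pv p beta t m).

Let W_ge0 b r t m : (forall t, 0 <= b t) -> 0 <= r -> 0 <= W b r t m.
Proof. by move=> b0 r0; case: m => m //=; rewrite mulr_ge0 // pv_ge0. Qed.

Let W_step b r t m : p * W b r t.+1 (m.+1%:Z + 1) +
  (1 - p) * W b r t.+1 (m.+1%:Z - 1) = W b r t m.+1%:Z.
Proof.
by rewrite /W extend_step /= [in RHS]pv_step // mulrDr !(mulrCA r).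
Qed.

Let W_le0 b r t z : z <= 0 -> (forall t, b t = r * delta t) -> W b r t z = r * delta t.
Proof. by case: z => [[|m]|m] //= _ br; rewrite ?br // pv0r. Qed.

Let W_le b r t z : 0 <= r -> (forall t, b t <= r * delta t) -> W b r t z <= r * delta t.
Proof. by move=> r0 br; case: z => m //=; rewrite ler_wpM2l // pv_le. Qed.

(** The value of never stopping against an opponent who stops in (0, y]. *)
Lemma wait_for_opponent_ge m :
  ((N * pv p beta 0 m.+1)%:E <= Jcont P X firm T set0 (u ^+ m.+1 * y))%E.
Proof.
apply: (J_ge (k := m.+1%:Z) (G := W (fun t => N * delta t) N)) => //.
- by move=> t z; apply: W_ge0.
- move=> s w _; rewrite hit_pos0 xmin_Nonel => E.
  rewrite W_le0 //; last exact: at_hit E.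
  by rewrite (payoff_yielded_to E) ?hit_pos0 // mulrC.
- by move=> n w; apply: W_le.
- move=> n w _; rewrite hit_pos0 xmin_Nonel => /before_hit[m' ->].
  by rewrite W_step.
Qed.

(** No stopping time does better, if the payoff of conceding m levels above y is at
    most N alpha^m. *)
Lemma wait_for_opponent_le tau m : determined_time X tau ->
  (forall m, f (u ^+ m * y) <= N * alpha ^+ m) ->
  (J P X firm (u ^+ m.+1 * y) tau (hit X T) <= (N * pv p beta 0 m.+1)%:E)%E.
Proof.
move=> dt fN.
apply: (J_le (k := m.+1%:Z) (G := W (fun t => N * delta t) N)) => //.
- by move=> t z; apply: W_ge0.
- move=> s w _ E.
  have [Zs|Zs] := leP (Z s w) 0.
    by rewrite W_le0 //; have /andP[] := payoff_bounds E.
  (* above y the opponent has not stopped yet *)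
  have nT : ~~ xle (hit X T w) (Some s).
    apply/negP => Ts; move: Zs; rewrite ltNge => /negP; apply.
    have := E; rewrite /xmin; case E' : (hit X T w) Ts => [b|] //= bs.
    case: ifP => [ab E2|_ [bs']]; last by rewrite -bs'; exact: at_hit E'.
    apply: at_hit; rewrite E'; congr Some; apply/eqP.
    by rewrite eqn_leq bs; move: ab; rewrite E2.
  have Et : tau w = Some s.
    have := E; rewrite /xmin; case: ifP => // _ E'.
    by move: nT; rewrite E' xle_refl.
  rewrite (payoff_concede Et nT); have [m' Em] := Zpos_pred Zs.
  rewrite Em /= XZ Em -exprnP.
  apply: le_trans (ler_wpM2l N0 (pv_ge s m'.+1)).
  by rewrite mulrCA ler_wpM2l // discount_ge0.
- move=> n w _ nE; have /before_hit[m' ->] : ~~ xle (hit X T w) (Some n).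
    by apply: contra nE; rewrite xle_xmin => ->; rewrite orbT.
  by rewrite W_step.
Qed.

(** The value of conceding on arrival in (0, y] when the opponent never stops. *)
Lemma wait_alone_ge m : y <= K ->
  (((K - y) * pv p beta 0 m.+1)%:E <= Jcont P X firm set0 T (u ^+ m.+1 * y))%E.
Proof.
move=> yK; have Ky0 : 0 <= K - y by rewrite subr_ge0.
have rd t : 0 <= (K - y) * delta t by rewrite mulr_ge0 // discount_ge0.
apply: (J_ge (k := m.+1%:Z) (G := W (fun t => (K - y) * delta t) (K - y))) => //.
- by move=> t z; apply: W_ge0.
- move=> s w _; rewrite hit0 xmin_None => E.
  have Zs := at_hit_pos E; rewrite W_le0 // (payoff_alone E) mulrC.
  rewrite ler_wpM2l ?discount_ge0 // le_max lerD2l lerN2.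
  by rewrite XZ ler_level // Zs.
- move=> n w; apply: le_trans (W_le _ _ _ _) _ => //.
  by rewrite ler_wpM2r ?discount_ge0 // (le_trans _ KN) // gerBl ltW.
- move=> n w X0; rewrite hit0 xmin_None => /(before_hit_pos X0)[m' ->].
  by rewrite W_step.
Qed.

(** No stopping time before that does better, if the payoff of conceding m levels
    above y is at most (K - y) alpha^m. *)
Lemma wait_alone_le tau m : determined_time X tau -> y <= K ->
  (forall w, xle (tau w) (hit_pos X T w)) ->
  (forall m, f (u ^+ m * y) <= (K - y) * alpha ^+ m) ->
  (J P X firm (u ^+ m.+1 * y) tau (hit X set0) <= ((K - y) * pv p beta 0 m.+1)%:E)%E.
Proof.
move=> dt yK tT fK; have Ky0 : 0 <= K - y by rewrite subr_ge0.
apply: (J_le (k := m.+1%:Z) (G := W (fun t => N * delta t) (K - y))) => //.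
- by move=> t z; apply: W_ge0.
- move=> s w _; rewrite hit0 xmin_None => E.
  rewrite (payoff_alone E); have := XZ s w; case: (Z s w) => m' Xm /=.
    apply: le_trans (ler_wpM2l Ky0 (pv_ge s m')).
    by rewrite mulrCA ler_wpM2l ?discount_ge0 // Xm -exprnP.
  by rewrite mulrC ler_wpM2r ?discount_ge0 // f_le_N.
- move=> n w X0; rewrite hit0 xmin_None => nE.
  have /(before_hit_pos X0)[m' ->] : ~~ xle (hit_pos X T w) (Some n).
    by apply: contra nE => /(xle_trans (tT w)).
  by rewrite W_step.
Qed.

(** One level above y, conceding at once is strictly better than every plan that
    waits for at least one period and concedes, at the latest, on arriving at y. *)
Lemma concede_now : alpha * (K - y) < K - u * y ->
  exists2 B : R, B < K - u * y &
  forall tau, determined_time X tau ->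
    (forall w, xle (Some 1%N) (tau w)) ->
    (forall w, xle (tau w) (hit_pos X T w)) ->
    (J P X firm (u * y) tau (hit X set0) <= B%:E)%E.
Proof.
move=> Hy.
have a0 : 0 < alpha by exact: pv01_gt0.
have a1 : alpha < 1 by exact: pv01_lt1.
have ruin : p * alpha <= 1 - p by exact: pv01_le_ruin.
have q0 : 0 < 1 - p by rewrite subr_gt0.
have b0 : 0 < 1 - alpha by rewrite subr_gt0.
pose M := (K - u * y - alpha * (K - y)) / (1 - alpha).
have M0 : 0 < M by rewrite divr_gt0 // subr_gt0.
have bound m := excess_bound u1 a0 a1 m y0 Hy.
have Ky0 : 0 <= K - y.
  have := bound 0%N; rewrite !expr0 !mul1r subrr mulr0 addr0 mulr1.
  by apply: le_trans; rewrite le_max lexx orbT.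
have d1 : delta 1%N < 1 by exact: discount1_lt1.
pose D (m : nat) := M * (1 - alpha ^+ m).
have D0 m : 0 <= D m.
  apply: mulr_ge0; first exact: ltW.
  by rewrite subr_ge0; apply: exprn_ile1; exact: ltW.
have D1 : D 1%N = K - u * y - alpha * (K - y).
  by rewrite /D expr1 divfK // lt0r_neq0.
(* alpha^m is a submartingale, as alpha does not exceed the ratio (1 - p) / p *)
have Dstep m : p * D m.+2 + (1 - p) * D m <= D m.+1.
  rewrite /D -subr_ge0 !exprS.
  rewrite (_ : _ - _ = M * (alpha ^+ m * ((1 - alpha) * (1 - p - p * alpha)))); last by ring.
  apply: mulr_ge0; first exact: ltW.
  apply: mulr_ge0; first by apply: exprn_ge0; exact: ltW.
  by apply: mulr_ge0; rewrite subr_ge0 // ltW.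
(* no stopping occurs at time 0, so the discount at time 1 may be used there *)
pose dd t := delta (maxn t 1).
have dd0 t : 0 <= dd t by exact: discount_ge0.
have ddS t : dd t.+1 <= dd t by apply: discount_nincr; rewrite // geq_max !leq_max leqnSn.
pose g t m := (K - y) * pv p beta t m + dd t * D m.
exists (g 0%N 1%N).
  rewrite /g /dd /= D1 -/alpha mulrC -ltrBrDl gtr_pMl // subr_gt0 //.
move=> tau dt t1 tT; rewrite -[u * y]/(u ^ 1%:Z * y).
apply: (J_le (k := 1) (G := extend (fun t => N * delta t) g)) => //.
- by move=> t [m|m] //=; rewrite /g addr_ge0 // mulr_ge0 // pv_ge0.
- move=> s w _; rewrite hit0 xmin_None => E.
  rewrite (payoff_alone E); have := XZ s w; case: (Z s w) => m Xm /=; last first.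
    by rewrite mulrC ler_wpM2r ?discount_ge0 // f_le_N.
  have s1 : maxn s 1 = s by apply/maxn_idPl; have := t1 w; rewrite E.
  rewrite /g /dd s1 Xm -exprnP.
  apply: (@le_trans _ _ (delta s * ((K - y) * alpha ^+ m + D m))).
    by rewrite ler_wpM2l ?discount_ge0.
  by rewrite mulrDr lerD2r mulrCA ler_wpM2l.
- move=> n w X0; rewrite hit0 xmin_None => nE.
  have X0' : X 0%N w = u ^+ 1 * y by [].
  have /(before_hit_pos X0')[m ->] : ~~ xle (hit_pos X T w) (Some n).
    by apply: contra nE => /(xle_trans (tT w)).
  rewrite extend_step /= /g [in leRHS]pv_step //.
  have := Dstep m => /(ler_wpM2l (dd0 n)).
  have : dd n.+1 * (p * D m.+2 + (1 - p) * D m) <= dd n * (p * D m.+2 + (1 - p) * D m).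
    by rewrite ler_wpM2r // addr_ge0 // mulr_ge0 // ltW.
  lra.
Qed.

(** The value of conceding after the first period. *)
Lemma concede_low tau k : determined_time X tau ->
  (forall w, xle (Some 1%N) (tau w)) -> 0 <= K ->
  (J P X firm (u ^ k * y) tau (hit X set0) <= (delta 1%N * K)%:E)%E.
Proof.
move=> dt t1 K0.
have dd0 t : 0 <= delta (maxn t 1) * K by rewrite mulr_ge0 // discount_ge0.
apply: (J_le (G := fun t _ => delta (maxn t 1) * K)) => //.
- move=> s w _; rewrite hit0 xmin_None => E; rewrite (payoff_alone E).
  have s1 : maxn s 1 = s by apply/maxn_idPl; have := t1 w; rewrite E.
  rewrite s1 ler_wpM2l ?discount_ge0 // ge_max K0 andbT gerBl ltW //.
  exact: (states_gt0 u1).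
- move=> n w _ _; rewrite -mulrDl addrC subrK mul1r ler_wpM2r //.
  by apply: discount_nincr; rewrite // geq_max !leq_max leqnSn.
Qed.

End relative_level.

Local Notation XX := (states u).

Lemma J_start x tau sigma c : XX x ->
  determined_time X tau -> determined_time X sigma ->
  (forall w, X 0%N w = x -> payoff X firm tau sigma w = c) ->
  J P X firm x tau sigma = c%:E.
Proof.
move=> sx dt ds; have [Z XZ hZ] := level_walk sx.
have := J_cst sx XZ hZ (k := 0) dt ds; rewrite expr0z mul1r; exact.
Qed.

Lemma Jstop_outside T x : XX x -> ~ T x -> Jstop P X firm T x = (f x)%:E.
Proof.
move=> sx nT; apply: J_start => // w X0; rewrite (payoff_concede (s := 0%N)) //.
  by rewrite discount0 mul1r X0.
by apply/negP => /xinf_le[s]; rewrite leqn0 => /eqP -> /=; rewrite X0.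
Qed.

Lemma Jstop_inside T x : XX x -> T x -> Jstop P X firm T x = (h x)%:E.
Proof.
move=> sx Tx; apply: J_start => // w X0.
rewrite /payoff /hit (@xinf_eqSome _ 0%N) //=; last by rewrite X0.
by rewrite discount0 mul1r X0.
Qed.

Lemma Jcont_inside T S x : XX x -> T x -> Jcont P X firm T S x = N%:E.
Proof.
move=> sx Tx; apply: J_start => // w X0.
have h0 : hit X T w = Some 0%N by apply: xinf_eqSome => //=; rewrite X0.
rewrite (payoff_yielded_to h0) ?discount0 ?mul1r //.
by apply/negP => /xinf_le[s]; rewrite leqn0 => /eqP -> [].
Qed.

Lemma Jcont_le_V T S S' x : S `<=` S' ->
  (Jcont P X firm T S' x <= V P X firm T x S)%E.
Proof.
move=> SS'; apply: ereal_sup_ubound; exists (hit_pos X S') => //; split.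
  exact: stopping_time_hit_pos.
move=> w; split.
  case E : (hit_pos X S' w) => [s|] //=.
  by have [[]] := xinf_Some E.
by apply: xle_antisub => s [s0 /SS'].
Qed.

(** ** Iterates of Phi *)

Local Notation iterPhi T n := (iter n (Phi XX P X firm T) set0).

(** A state enters an iterate of Phi because stopping there beats every plan that
    waits at most until the previous iterate is reached. If an equilibrium E contains
    the previous iterate, waiting until E is reached is one of these plans. *)
Lemma iterPhi_sub_equilibrium T E n :
  intra_equilibrium XX P X firm T E -> iterPhi T n `<=` E.
Proof.
move=> [EX EE]; elim: n => [|n IH] //= x [/IH//|[Xx [nS VJ]]].
have JJ := le_lt_trans (Jcont_le_V T x IH) VJ.
rewrite -EE; case: (pselect (E x)) => Ex; last by right.
by left; split => //; split => //; exact: ltW.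
Qed.

Lemma iterPhi_stop T E n x : (forall m, iterPhi T m `<=` E) ->
  iterPhi T n x -> (Jcont P X firm T E x < Jstop P X firm T x)%E.
Proof.
move=> HE; elim: n => [|n IH] //= [/IH//|[Xx [nS VJ]]].
exact: le_lt_trans (Jcont_le_V T x (HE n)) VJ.
Qed.

(** ** A firm whose opponent never stops *)

Section alone.
Variable y : R.
Let a := pv p beta 0 1.
Let c := (1 - a) / (u - a) * K.
Hypotheses (K0 : 0 < K) (sy : XX y) (cy : c <= y) (yc : y / u < c) (yK : y <= K).
Let T := `]0, y]%classic `&` XX.

Let a0 : 0 < a. Proof. exact: pv01_gt0. Qed.
Let a1 : a < 1. Proof. exact: pv01_lt1. Qed.
Let y0 : 0 < y. Proof. exact: (states_gt0 u1). Qed.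

Let f_le m : f (u ^+ m * y) <= (K - y) * a ^+ m.
Proof. by rewrite [leRHS]mulrC; exact: above_threshold. Qed.

Lemma alone_wait x : XX x -> ~ T x ->
  (Jstop P X firm set0 x <= Jcont P X firm set0 T x)%E.
Proof.
move=> sx nT; rewrite Jstop_outside //; have [m ->] := halfline_above u1 sx sy nT.
have [Z XZ hZ] := level_walk sy.
apply: le_trans (wait_alone_ge sy XZ hZ m yK); rewrite lee_fin.
apply: le_trans (f_le _) _; rewrite ler_wpM2l ?subr_ge0 //.
by have := pv_ge_expr p0 p1 beta0 0 m.+1; rewrite discount0 mul1r.
Qed.

Lemma alone_wait_best S x : T `<=` S -> XX x -> ~ T x ->
  (Jcont P X firm set0 S x <= Jcont P X firm set0 T x)%E.
Proof.
move=> TS sx nT; have [m ->] := halfline_above u1 sx sy nT.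
have [Z XZ hZ] := level_walk sy.
apply: le_trans (wait_alone_ge sy XZ hZ m yK).
apply: (wait_alone_le sy XZ hZ) => // w.
by apply: xle_antisub => s [s0 /TS].
Qed.

Lemma iterPhi_sub_halfline n : iterPhi set0 n `<=` T.
Proof.
elim: n => [|n IH] //= x [/IH//|[sx [_ VJ]]]; apply: contrapT => nT.
have := le_lt_trans (Jcont_le_V set0 x IH) VJ.
by rewrite ltNge alone_wait.
Qed.

Lemma halfline_sub_iterPhi x : T x -> exists n, iterPhi set0 n.+1 x.
Proof.
have d1 : discount beta 1 < 1 by exact: discount1_lt1.
(* half of the bound below which K - x exceeds the payoff K after one period *)
pose e := K * (1 - discount beta 1) / 2.
have e0 : 0 < e by rewrite divr_gt0 // mulr_gt0 // subr_gt0.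
suff H n z : T z -> z <= u ^+ n * e -> iterPhi set0 n.+1 z.
  move=> Tx; have [n Hn] := states_small u1 e0 (states_gt0 u1 (proj2 Tx)).
  by exists n; exact: H.
elim: n z => [|n IH] z Tz ze; have sz := proj2 Tz; have z0 := states_gt0 u1 sz.
  right; split => //; split => //; rewrite Jstop_outside //.
  apply: (@le_lt_trans _ _ (discount beta 1 * K)%:E); last first.
    rewrite lte_fin lt_max; apply/orP; left.
    have : e < K * (1 - discount beta 1).
      by rewrite /e ltr_pdivrMr // ltr_pMr ?ltr1n // mulr_gt0 // subr_gt0.
    move: ze; rewrite expr0 mul1r; lra.
  apply: ge_ereal_sup => _ [tau [st Ht] <-].
  have [Z XZ hZ] := level_walk sz.
  have := concede_low sz XZ hZ 0 (stopping_time_determined st).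
  by rewrite expr0z mul1r; apply => [w|]; [exact: (Ht w).1|exact: ltW].
have [Iz|nIz] := pselect (iterPhi set0 n.+1 z); first by left.
right; split => //; split => //; rewrite Jstop_outside //.
(* the next lower state, below which all states have already been collected *)
pose z' := z / u.
have zz' : u * z' = z by rewrite mulrC divfK.
have sz' : XX z' by rewrite /z' mulrC -exprN1; exact: states_mulz.
have z'0 := states_gt0 u1 sz'.
have zy : z <= y by have [+ _] := Tz; rewrite /= in_itv /= => /andP[].
have z'c : z' < c by apply: le_lt_trans yc; rewrite ler_pM2r ?invr_gt0.
have sub : `]0, z']%classic `&` XX `<=` iterPhi set0 n.+1.
  move=> v [/=]; rewrite in_itv /= => /andP[v0 vz'] sv; apply: IH.
    split; rewrite //= in_itv /= v0 /=; apply: le_trans zy; apply: le_trans vz' _.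
    by rewrite -zz' ler_peMl // ltW.
  by apply: le_trans vz' _; rewrite ler_pdivrMr // mulrC mulrA -exprS.
have [Z XZ hZ] := level_walk sz'.
have [B BK HB] := concede_now sz' XZ hZ (below_threshold u1 a1 z'c).
apply: (@le_lt_trans _ _ B%:E); last first.
  by rewrite lte_fin lt_max -zz' BK.
apply: ge_ereal_sup => _ [tau [st Ht] <-]; rewrite -zz'; apply: HB.
- exact: stopping_time_determined.
- by move=> w; exact: (Ht w).1.
- move=> w; apply: xle_trans (Ht w).2 _.
  by apply: xle_antisub => s [s0 /sub].
Qed.

Lemma Gamma_alone : Gamma XX P X firm set0 = T.
Proof.
apply/seteqP; split => x.
  by move=> [n _]; exact: iterPhi_sub_halfline.
by move=> /halfline_sub_iterPhi[n Hn]; exists n.+1.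
Qed.

Lemma halfline_stop x : T x ->
  (Jcont P X firm set0 T x < Jstop P X firm set0 x)%E.
Proof.
move=> /halfline_sub_iterPhi[n Hn].
by apply: (iterPhi_stop _ Hn) => m; exact: iterPhi_sub_halfline.
Qed.

Lemma alone_optimal : optimal_intra_equilibrium XX P X firm set0 T.
Proof.
split.
  split; first by move=> x [].
  apply/seteqP; split => x.
    move=> [[_ []//]|[sx [nT]]].
    by rewrite ltNge alone_wait.
  move=> Tx; left; split; first by case: Tx.
  by split => //; exact/ltW/halfline_stop.
move=> S eqS x sx.
have TS : T `<=` S.
  by move=> z /halfline_sub_iterPhi[n]; exact: iterPhi_sub_equilibrium.
rewrite /U ge_max !le_max lexx /=.
case: (pselect (T x)) => Tx; last by rewrite (alone_wait_best TS sx Tx) orbT.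
have : Theta XX P X firm set0 S x by rewrite (proj2 eqS); exact: TS.
by move=> [[_ [_ ->]]//|[_ [nS]]]; have := TS _ Tx.
Qed.

End alone.

(** ** A firm whose opponent stops below y *)

Section against_halfline.
Variable y : R.
Hypotheses (sy : XX y).
Let T := `]0, y]%classic `&` XX.
Hypothesis f_le : forall m, f (u ^+ m * y) <= N * pv p beta 0 1 ^+ m.

Lemma never_stop x : XX x ->
  (Jstop P X firm T x <= Jcont P X firm T set0 x)%E.
Proof.
move=> sx; case: (pselect (T x)) => Tx.
  by rewrite Jstop_inside // Jcont_inside // lee_fin h_le_N.
rewrite Jstop_outside //; have [m ->] := halfline_above u1 sx sy Tx.
have [Z XZ hZ] := level_walk sy.
apply: le_trans (wait_for_opponent_ge sy XZ hZ m); rewrite lee_fin.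
apply: le_trans (f_le _) _; rewrite ler_wpM2l //.
by have := pv_ge_expr p0 p1 beta0 0 m.+1; rewrite discount0 mul1r.
Qed.

Lemma never_stop_best S x : XX x ->
  (Jcont P X firm T S x <= Jcont P X firm T set0 x)%E.
Proof.
move=> sx; case: (pselect (T x)) => Tx; first by rewrite !Jcont_inside.
have [m ->] := halfline_above u1 sx sy Tx; have [Z XZ hZ] := level_walk sy.
apply: le_trans (wait_for_opponent_ge sy XZ hZ m).
exact: (wait_for_opponent_le sy XZ hZ).
Qed.

Lemma against_halfline_optimal : optimal_intra_equilibrium XX P X firm T set0.
Proof.
split.
  split => //; apply/seteqP; split => // x [[_ []//]|[sx [_]]].
  by rewrite ltNge never_stop.
move=> S _ x sx; rewrite /U ge_max !le_max lexx /=.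
by rewrite never_stop_best // orbT.
Qed.

Lemma Gamma_against_halfline : Gamma XX P X firm T = set0.
Proof.
apply/seteqP; split => // x [n _].
exact: (iterPhi_sub_equilibrium (proj1 against_halfline_optimal)).
Qed.

End against_halfline.

End one_firm.

End payoffs.

(** The threshold does not exceed K, because (1 - a) u <= u - a. *)
Lemma threshold_spec {R : realType} (u a K : R) :
  1 < u -> 0 < a -> a < 1 -> 0 < K ->
  let c := (1 - a) / (u - a) * K in
  let y := set_min (`[c, +oo[ `&` states u) in
  [/\ states u y, c <= y, y / u < c & y <= K].
Proof.
move=> u1 a0 a1 K0 c y.
have ua : 0 < u - a by rewrite subr_gt0 (lt_trans a1).
have u0 : 0 < u by exact: lt_trans u1.
have c0 : 0 < c by rewrite mulr_gt0 // divr_gt0 // subr_gt0.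
have [sy cy ymin] := set_min_states u1 c0.
have y0 : 0 < y by exact: states_gt0 sy.
have yc : y / u < c.
  rewrite ltNge; apply/negP => cyu.
  have syu : states u (y / u) by rewrite mulrC -exprN1; exact: states_mulz.
  have := ymin _ syu cyu; rewrite leNgt => /negP; apply.
  by rewrite ltr_pdivrMr // ltr_pMr.
split => //; move: yc; rewrite ltr_pdivrMr // => /ltW/le_trans; apply.
have -> : c * u = K * ((1 - a) * u) / (u - a) by rewrite /c; ring.
rewrite ler_pdivrMr // ler_pM2l // mulrBl mul1r lerD2l lerN2.
by rewrite ler_peMr ?(ltW u1) ?(ltW a0).
Qed.

Theorem proposition5p1 (R : realType)
    (d : measure_display) (Omega : measurableType d)
    (P : R -> probability Omega R) (X : nat -> Omega -> R)
    (d' : measure_display) (Omega' : measurableType d')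
    (Q : probability Omega' R) (Y : nat -> Omega' -> int)
    (u p Rtot N K beta1 beta2 : R) (h1 h2 : R -> R)
    (S T : nat -> set R)
    (hu : 1 < u) (hp0 : 0 < p) (hp1 : p < 1) (hpu : 1 / (u + 1) <= p)
    (hX : multiplicative_walk u p P X)
    (hY : integer_walk p Q Y)
    (hY1 : (0 < Q (Y 0%N @^-1` [set 1%:Z]))%E)
    (hR : 0 < Rtot) (hN : Rtot / 2 < N) (hNR : N < Rtot) (hK : K = Rtot - N)
    (hb1 : 0 < beta1) (hb2 : 0 < beta2)
    (hh1 : forall x, states u x ->
       concede (firm K N beta1 h1) x <= h1 x <= yielded_to (firm K N beta1 h1) x)
    (hh2 : forall x, states u x ->
       concede (firm K N beta2 h2) x <= h2 x <= yielded_to (firm K N beta2 h2) x)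
    (hb12 : beta1 <= beta2)
    (hS0 : S 0%N = set0)
    (hT : forall n, T n = Gamma (states u) P X (firm K N beta2 h2) (S n))
    (hS : forall n, S n.+1 = Gamma (states u) P X (firm K N beta1 h1) (T n)) :
  (forall n, S n = S 0%N /\ T n = T 0%N) /\
  (\bigcup_n S n, \bigcap_n T n) = (S 0%N, T 0%N) /\
  (S 0%N, T 0%N) =
    (set0, `]0, threshold u K beta2 Q Y]%classic `&` states u) /\
  sharp_equilibrium (states u) P X (firm K N beta1 h1) (firm K N beta2 h2)
    (\bigcup_n S n, \bigcap_n T n).
Proof.
have K0 : 0 < K by rewrite hK subr_gt0.
have KN : K <= N by lra.
have N0 : 0 <= N by apply: le_trans KN; exact: ltW.
pose a1 := pv p beta1 0 1; pose a2 := pv p beta2 0 1.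
have a20 : 0 < a2 by exact: pv01_gt0.
have a21 : a2 < 1 by exact: pv01_lt1.
have a12 : a2 <= a1 by exact: pv_antitone.
have [] := threshold_spec hu a20 a21 K0.
rewrite /a2 -(alphaE hp0 hp1 hY hb2 hY1) -/(threshold u K beta2 Q Y).
set y := threshold _ _ _ _ _; rewrite (alphaE hp0 hp1 hY hb2 hY1) => sy cy yc yK.
set T0 := `]0, y] `&` states u.
have f1 m : Num.max (K - u ^+ m * y) 0 <= N * a1 ^+ m.
  apply: le_trans (above_threshold hu a20 a21 K0 m cy yK) _.
  have y0 := states_gt0 hu sy.
  have a10 : 0 < a1 by exact: lt_le_trans a12.
  rewrite mulrC; apply: ler_pM; rewrite ?subr_ge0 ?exprn_ge0 ?(ltW a20) //.
    by apply: le_trans KN; rewrite gerBl ltW.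
  by rewrite lerXn2r // nnegrE ltW.
have G1 := Gamma_against_halfline hu hp0 hp1 hX hb1 KN N0 hh1 sy f1.
have G2 := Gamma_alone hu hp0 hp1 hX hb2 KN N0 hh2 K0 sy cy yc yK.
have S0 n : S n = set0.
  by elim: n => [|n IH]; rewrite ?hS0 // hS hT IH G2.
have TT n : T n = T0 by rewrite hT S0.
have bigS : \bigcup_n S n = set0 by apply: bigcup0 => n _.
have bigT : \bigcap_n T n = T0.
  by apply/seteqP; split => x; [move=> /(_ 0%N I); rewrite TT | move=> Tx n _; rewrite TT].
rewrite bigS bigT S0 TT; split; first by move=> n; rewrite S0 TT.
split=> //; split=> //; split=> /=.
- exact: (against_halfline_optimal hu hp0 hp1 hX hb1 KN N0 hh1 sy f1).
- exact: (alone_optimal hu hp0 hp1 hX hb2 KN N0 hh2 K0 sy cy yc yK).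
Qed.
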